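(* Let $\Lambda$ be an artin algebra which is neither Nakayama nor right $2$-Nakayama. Then $\Lambda$ is right $3$-Nakayama if and only if every indecomposable right $\Lambda$-module $M$ with $l(M)>4$ is uniserial and every indecomposable right $\Lambda$-module $M$ with $l(M)=4$ is local.
   Context: An artin algebra is an algebra over a commutative artinian ring $R$ that is finitely generated as an $R$-module. All modules are finitely generated right modules; $l(M)$ is the length of $M$. A module is local if it has a unique maximal submodule (equivalently, simple top). Put $\mathrm{rad}^0(M)=M$. A module is uniserial ($1$-factor serial) if it has a unique composition series (the zero module counts as uniserial). For $n>1$, a non-uniserial module $M$ of length $l\geq n$ is $n$-factor serial if $M/\mathrm{rad}^{l-n}(M)$ is uniserial and $M/\mathrm{rad}^{l-n+1}(M)$ is not uniserial. $\Lambda$ is Nakayama if every indecomposable right $\Lambda$-module is uniserial. For $n>1$, $\Lambda$ is right $n$-Nakayama if every indecomposable right $\Lambda$-module is $i$-factor serial for some $1\leq i\leq n$ and there exists at least one indecomposable $n$-factor serial right $\Lambda$-module. *)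

(* Defs.v *)
From HB Require Import structures.
From mathcomp Require Import all_boot all_algebra.
From mathcomp Require Import all_classical.

Set Implicit Arguments.
Unset Strict Implicit.
Unset Printing Implicit Defensive.

Import GRing.Theory.

Local Open Scope classical_set_scope.
Local Open Scope quotient_scope.
Local Open Scope ring_scope.

Section Submodules.
Variables (R : pzRingType) (V : lmodType R).
Implicit Types (N K L : set V).

Definition submodule N : Prop := GRing.submod_closed [in N].

Definition maximal_submodule K N : Prop :=
  [/\ submodule K, K `<` N &
      forall L, submodule L -> K `<=` L -> L `<=` N -> L = K \/ L = N].

Definition finitely_generated : Prop :=
  exists n (e : 'I_n -> V), forall v, exists c : 'I_n -> R,
    v = \sum_(i < n) c i *: e i.

Definition artinian_module : Prop :=
  forall N : nat -> set V, (forall i, submodule (N i)) ->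
    (forall i, N i.+1 `<=` N i) ->
    exists n, forall m, (n <= m)%N -> N m = N n.

(* The zero submodule is left out of the list, so that size s is the number
   of composition factors. *)
Definition composition_series (s : seq (set V)) : Prop :=
  path (fun K N => `[< maximal_submodule K N >]) [set 0] s
  /\ last [set 0] s = [set: V].

Definition uniserial : Prop := exists! s, composition_series s.

(* Well defined by Jordan-Hoelder; 0 by convention if there is no composition
   series. *)
Definition module_length : nat :=
  xget 0%N [set n | exists2 s, composition_series s & size s = n].

Definition local_module : Prop := exists! K, maximal_submodule K [set: V].

Definition indecomposable : Prop :=
  [set: V] <> [set 0] /\
  forall N K, submodule N -> submodule K ->
    N `&` K = [set 0] ->
    (forall v, exists2 x, N x & exists2 y, K y & v = x + y) ->
    N = [set 0] \/ K = [set 0].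

(* rad N is N itself if N has no maximal submodule. *)
Definition rad N : set V :=
  [set x | N x /\ forall K, maximal_submodule K N -> K x].

Definition radn (k : nat) : set V := iter k rad [set: V].

Lemma submodule_setT : submodule [set: V].
Proof. by split=> [|a u v _ _]; rewrite !inE. Qed.

Lemma submodule_rad N : submodule N -> submodule (rad N).
Proof.
move=> [N0 Nlin]; split=> [|a u v].
  rewrite inE; split; first by rewrite inE in N0.
  by move=> K [[K0 _] _ _]; rewrite inE in K0.
rewrite !inE => -[Nu Ku] [Nv Kv]; split.
  by have := Nlin a u v; rewrite !inE; apply.
move=> K Kmax; case: (Kmax) => -[_ Klin] _ _.
by have := Klin a u v; rewrite !inE; apply; [apply: Ku | apply: Kv].
Qed.

Lemma submodule_radn k : submodule (radn k).
Proof. by elim: k => [|k]; [apply: submodule_setT | apply: submodule_rad]. Qed.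

End Submodules.

Arguments finitely_generated {R} V.
Arguments artinian_module {R} V.
Arguments uniserial {R} V.
Arguments module_length {R} V.
Arguments local_module {R} V.
Arguments indecomposable {R} V.
Arguments radn {R} V k.

(* The library has {ideal_quot I} only as a zmodType (or a commutative ring);
   the scalar action is added here. *)
Section QuotientModule.
Variables (R : pzRingType) (V : lmodType R) (N : set V) (HN : submodule N).

Definition submodule_pred of submodule N : {pred V} := [in N].

HB.instance Definition _ :=
  GRing.isSubmodClosed.Build R V (submodule_pred HN)
    (GRing.submod_closed_semi HN).

Definition quotient_module : Type := {ideal_quot (submodule_pred HN)}.

HB.instance Definition _ := EqQuotient.on quotient_module.
HB.instance Definition _ := GRing.Zmodule.on quotient_module.

Lemma quotient_eqP (x y : V) :
  reflect (x = y %[mod quotient_module]) (x - y \in submodule_pred HN).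
Proof. by rewrite Quotient.idealrBE; exact: eqP. Qed.

Lemma quotient_piD :
  {morph \pi_quotient_module : x y / x + y >-> x + y}.
Proof. exact: Quotient.pi_add. Qed.

Definition quotient_scale (a : R) (q : quotient_module) : quotient_module :=
  \pi_quotient_module (a *: repr q).

Lemma quotient_scale_pi (a : R) (x : V) :
  quotient_scale a (\pi_quotient_module x) = \pi_quotient_module (a *: x).
Proof.
apply/quotient_eqP; rewrite -scalerBr rpredZ //.
by apply/quotient_eqP; rewrite reprK.
Qed.

Fact quotient_scalerA a b q :
  quotient_scale a (quotient_scale b q) = quotient_scale (a * b) q.
Proof.
by elim/quotW: q => x; rewrite (quotient_scale_pi b) !quotient_scale_pi scalerA.
Qed.

Fact quotient_scale1r : left_id 1 quotient_scale.
Proof. by elim/quotW => x; rewrite quotient_scale_pi scale1r. Qed.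

Fact quotient_scalerDr : right_distributive quotient_scale +%R.
Proof.
move=> a; elim/quotW => x; elim/quotW => y.
by rewrite -quotient_piD !quotient_scale_pi scalerDr quotient_piD.
Qed.

Fact quotient_scalerDl q : {morph quotient_scale^~ q : a b / a + b}.
Proof.
by elim/quotW: q => x a b; rewrite !quotient_scale_pi scalerDl quotient_piD.
Qed.

HB.instance Definition _ := GRing.Zmodule_isLmodule.Build R quotient_module
  quotient_scalerA quotient_scale1r quotient_scalerDr quotient_scalerDl.

End QuotientModule.

Definition quot_radn (R : pzRingType) (V : lmodType R) (k : nat) : lmodType R :=
  quotient_module (submodule_radn V k).

Definition factor_serial (R : pzRingType) (V : lmodType R) (n : nat) : Prop :=
  match n with
  | 0 => False
  | 1 => uniserial V
  | _ => let l := module_length V in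
         [/\ ~ uniserial V, (n <= l)%N,
             uniserial (quot_radn V (l - n)) &
             ~ uniserial (quot_radn V (l - n).+1)]
  end.

(* R^o is R as a module over itself, so its submodules are the ideals. *)
Definition artin_algebra (R : comPzRingType) (A : algType R) : Prop :=
  artinian_module R^o /\ finitely_generated A.

(* A right A-module is a left module over the converse ring A^c: the action
   v . a is written a *: v. *)
Definition nakayama (A : pzRingType) : Prop :=
  forall M : lmodType A^c, finitely_generated M -> indecomposable M ->
    uniserial M.

Definition right_nakayama (n : nat) (A : pzRingType) : Prop :=
  [/\ (1 < n)%N,
      forall M : lmodType A^c, finitely_generated M -> indecomposable M ->
        exists2 i, (1 <= i <= n)%N & factor_serial M i &
      exists M : lmodType A^c,
        [/\ finitely_generated M, indecomposable M & factor_serial M n]].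

(* Main.v *)
From HB Require Import structures.
From mathcomp Require Import all_boot all_algebra.
From mathcomp Require Import all_classical.
Require Import Defs.

(* Write W_j = rad^j M.  A non-uniserial M of length l is n-factor serial
   exactly when n = l - t, where t is the first index such that W_t / W_(t+1)
   is neither simple nor zero.  So everything reduces to excluding t >= 2 for
   an indecomposable M over a right 3-Nakayama algebra.  Suppose t >= 2, put
   P = W_(t-2), Q = W_(t-1), W = W_t, and let K1 <> K2 be maximal submodules
   of W.  Gluing P / (K1 `&` K2) and Q / K2 along the simple module W / K2
   (isomorphic to K1 / (K1 `&` K2)) gives a module N of length 5 with two
   distinct maximal submodules.  N is indecomposable: if N = X + Y is direct,
   rad N is the direct sum of rad X and rad Y, but rad N is local, so it lies
   in X, say; since the socle of N is contained in rad N, this forces Y = 0.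
   Being indecomposable of length 5 and not local, N is not i-factor serial
   for any i <= 3. *)

Set Implicit Arguments.
Unset Strict Implicit.
Unset Printing Implicit Defensive.

Import GRing.Theory.
Local Open Scope classical_set_scope.
Local Open Scope quotient_scope.
Local Open Scope ring_scope.

(** * Composition series *)

(** The forward direction reduces to arithmetic for a non-uniserial indecomposable: n = l - t <= 3
    with l > 4 forces t >= 2, and with l = 4 it forces t >= 1, which is locality. The same bound
    makes every indecomposable of length above 3 local, which is what the glued module contradicts.
    Conversely, the two negative hypotheses supply the required 3-factor serial module. The two
    pieces are cut unequally on purpose. A pushout of P / K2 and Q / K2 along W / K2 would split,
    because the inclusion of Q into P induces a map Q / K2 -> P / K2 extending the identity of W /
    K2. Keeping both legs of the fork in P / (K1 cap K2) removes that map. The piece lengths 4 and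
    2, less the shared simple module, give 5. Arguments run among submodules of V, or of V x V,
    lying between two fixed ones; the glued quotient is formed only at the end. Lengths and enough
    maximal submodules require finite length, which must first be derived from descending chains of
    ideals of the base ring. *)

Section SubmoduleTheory.
Variables (R : pzRingType) (V : lmodType R).
Implicit Types (N K L X Y : set V).

Lemma submoduleI N :
  N 0 -> (forall a u v, N u -> N v -> N (a *: u + v)) -> submodule N.
Proof. by move=> N0 NL; split=> [|a u v]; rewrite !inE //; exact: NL. Qed.

Lemma submodule_lin N a u v : submodule N -> N u -> N v -> N (a *: u + v).
Proof. by case=> _ /(_ a u v); rewrite !inE. Qed.

Lemma submodule0 N : submodule N -> N 0.
Proof. by case; rewrite inE. Qed.

Lemma submoduleZ N a u : submodule N -> N u -> N (a *: u).
Proof.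
by move=> sN Nu; rewrite -[_ *: _]addr0; apply: submodule_lin (submodule0 sN).
Qed.

Lemma submoduleD N u v : submodule N -> N u -> N v -> N (u + v).
Proof. by move=> sN Nu Nv; rewrite -[u]scale1r; apply: submodule_lin. Qed.

Lemma submoduleN N u : submodule N -> N u -> N (- u).
Proof. by move=> sN Nu; rewrite -scaleN1r; apply: submoduleZ. Qed.

Lemma submoduleB N u v : submodule N -> N u -> N v -> N (u - v).
Proof. by move=> sN Nu Nv; apply: submoduleD (submoduleN _ _). Qed.

Lemma submodule_set0 : submodule [set 0 : V].
Proof. by apply: submoduleI => // a u v -> ->; rewrite scaler0 addr0. Qed.

Lemma sub0_submodule N : submodule N -> [set 0] `<=` N.
Proof. by move=> sN _ ->; exact: submodule0. Qed.

Lemma submodule_cap N K : submodule N -> submodule K -> submodule (N `&` K).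
Proof.
move=> sN sK; apply: submoduleI => [|a u v [Nu Ku] [Nv Kv]].
  by split; exact: submodule0.
by split; exact: submodule_lin.
Qed.

Lemma maximal_submoduleI K N :
  submodule K -> K `<=` N -> K <> N ->
  (forall L, submodule L -> K `<=` L -> L `<=` N -> L <> K -> N `<=` L) ->
  maximal_submodule K N.
Proof.
move=> sK KN neq maxK; split=> //.
  by split=> // NK; apply: neq; apply/seteqP.
move=> L sL KL LN; have [->|nLK] := pselect (L = K); first by left.
by right; apply/seteqP; split=> //; exact: maxK.
Qed.

Lemma maximal_sub K N : maximal_submodule K N -> K `<=` N.
Proof. by case=> _ []. Qed.

Lemma maximal_neq K N : maximal_submodule K N -> K <> N.
Proof. by case=> _ [_ NK] _ eqKN; apply: NK; rewrite eqKN. Qed.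

Lemma maximal_submoduleP K N : maximal_submodule K N -> submodule K.
Proof. by case. Qed.

(** Relative composition series indexed by length, easy to concatenate and to transport between
    modules. [maximal_submodule N N'] does not say that [N'] is a submodule, hence the extra
    premise. *)
Inductive series : set V -> set V -> nat -> Prop :=
| series_refl K : submodule K -> series K K 0
| series_step K N N' n : series K N n -> maximal_submodule N N' ->
    submodule N' -> series K N' n.+1.

Lemma series_submodl K N n : series K N n -> submodule K.
Proof. by elim. Qed.

Lemma series_submodr K N n : series K N n -> submodule N.
Proof. by case. Qed.

Lemma series_sub K N n : series K N n -> K `<=` N.
Proof.
by elim=> [{}K _ //|{}K {}N N' {}n _ KN /maximal_sub NN' _ x /KN /NN'].
Qed.

Lemma series_trans K L N m n :
  series K L m -> series L N n -> series K N (m + n).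
Proof.
move=> sKL sLN; elim: sLN K sKL => [{}L _ K|{}L {}N N' {}n _ IH mN sN' K KL].
  by rewrite addn0.
by rewrite addnS; apply: series_step mN sN'; exact: IH.
Qed.

Lemma series1 K N : maximal_submodule K N -> submodule N -> series K N 1.
Proof.
move=> mK sN; apply: series_step (mK) sN; apply: series_refl.
exact: maximal_submoduleP mK.
Qed.

Lemma series_last K N n : series K N n -> K <> N ->
  exists2 N', maximal_submodule N' N & series K N' n.-1.
Proof. by case=> // {}K {}N N' {}n sKN mN _ _; exists N. Qed.

Lemma series_path K N n : submodule N -> (exists s,
    [/\ path (fun K N => `[< maximal_submodule K N >]) K s, last K s = N
       & size s = n]) -> submodule K -> series K N n.
Proof.
move=> sN [s [ps ls <-]] sK.
elim/last_ind: s N ps ls sN => [|s N' IH] N /=; first by move=> _ <- _;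
  exact: series_refl.
rewrite rcons_path last_rcons size_rcons => /andP[ps /asboolP mN] <- sN'.
by apply: (series_step _ mN sN'); apply: IH => //; case: mN.
Qed.

Lemma series_pathE K N n : series K N n -> exists s,
    [/\ path (fun K N => `[< maximal_submodule K N >]) K s, last K s = N
       & size s = n].
Proof.
elim=> [{}K _|{}K {}N N' {}n _ [s [ps ls <-]] mN _]; first by exists [::].
exists (rcons s N'); rewrite rcons_path last_rcons size_rcons ps ls; split=> //.
exact/asboolP.
Qed.

Definition finite_length : Prop := exists n, series [set 0] [set: V] n.

End SubmoduleTheory.

Arguments finite_length {R} V.

(** Images and preimages may collapse a maximal inclusion to an equality, so the transported length
    can only drop; uniqueness of length rests on this bound. *)
Lemma series_push (R : pzRingType) (V V' : lmodType R) (phi : set V -> set V')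
    (K N : set V) n :
  (forall X, submodule X -> submodule (phi X)) ->
  (forall X Y, submodule Y -> K `<=` X -> Y `<=` N -> maximal_submodule X Y ->
     phi X = phi Y \/ maximal_submodule (phi X) (phi Y)) ->
  series K N n -> exists2 m, (m <= n)%N & series (phi K) (phi N) m.
Proof.
move=> sphi mphi sKN; elim: sKN mphi =>
  [{}K sK _|{}K {}N N' {}n sKN IH mN sN' mphi].
  by exists 0%N => //; apply: series_refl; exact: sphi.
have [|m lemn sphiKN] := IH.
  move=> X Y sY KX YN; apply: mphi => //; apply: subset_trans YN _.
  exact: maximal_sub mN.
have [<-|mphiN] := mphi _ _ sN' (series_sub sKN) (@subset_refl _ _) mN.
  by exists m => //; exact: leqW.
by exists m.+1 => //; apply: series_step mphiN _ => //; exact: sphi.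
Qed.

Lemma series_push_strict (R : pzRingType) (V V' : lmodType R)
    (phi : set V -> set V') (K N : set V) n :
  (forall X, submodule X -> X `<=` N -> submodule (phi X)) ->
  (forall X Y, submodule Y -> K `<=` X -> Y `<=` N -> maximal_submodule X Y ->
     maximal_submodule (phi X) (phi Y)) ->
  series K N n -> series (phi K) (phi N) n.
Proof.
move=> sphi mphi sKN; elim: sKN sphi mphi =>
  [{}K sK sphi _|{}K {}N N' {}n sKN IH mN sN' sphi mphi].
  by apply: series_refl; exact: sphi.
have NN' := maximal_sub mN.
apply: (@series_step _ _ _ (phi N)); last exact: sphi.
  apply: IH => [X sX XN|X Y sY KX YN].
    by apply: sphi => //; exact: subset_trans NN'.
  by apply: mphi => //; exact: subset_trans NN'.
by apply: mphi => //; exact: series_sub sKN.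
Qed.

(** * Images and preimages of maximal inclusions *)

Section LinearOn.
Variables (R : pzRingType) (V V' : lmodType R).
Implicit Types (S K : set V) (N T : set V').

(* Linear on S only, so that the projection onto a subquotient S/L qualifies. *)
Definition linear_on S (f : V -> V') : Prop :=
  forall a u v, S u -> S v -> f (a *: u + v) = a *: f u + f v.

(** One formula for three uses: sums ([f] the identity), images ([N] zero), and adjoining a cyclic
    submodule ([K] the whole ring). *)
Definition image_plus N (f : V -> V') K : set V' :=
  [set y | exists2 z, N z & exists2 x, K x & y = z + f x].

Variables (S : set V) (f : V -> V').
Hypotheses (sS : submodule S) (lf : linear_on S f).

Lemma linear_on0 : f 0 = 0.
Proof.
have S0 := submodule0 sS.
by have := lf (-1) S0 S0; rewrite scaler0 addr0 scaleN1r addNr.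
Qed.

Lemma linear_onD u v : S u -> S v -> f (u + v) = f u + f v.
Proof. by move=> Su Sv; rewrite -[u in LHS]scale1r lf // scale1r. Qed.

Lemma linear_onZ a u : S u -> f (a *: u) = a *: f u.
Proof.
move=> Su; rewrite -[_ *: u]addr0 lf //; last exact: submodule0.
by rewrite linear_on0 addr0.
Qed.

Lemma linear_onB u v : S u -> S v -> f (u - v) = f u - f v.
Proof.
move=> Su Sv; rewrite linear_onD //; last exact: submoduleN.
by rewrite -scaleN1r linear_onZ // scaleN1r.
Qed.

Lemma submodule_image_plus N K :
  submodule N -> submodule K -> K `<=` S -> submodule (image_plus N f K).
Proof.
move=> sN sK KS; apply: submoduleI =>
  [|a u v [z Nz [x Kx ->]] [z' Nz' [x' Kx' ->]]].
  exists 0; first exact: submodule0.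
  by exists 0; [exact: submodule0|rewrite linear_on0 addr0].
exists (a *: z + z'); first exact: submodule_lin.
exists (a *: x + x'); first exact: submodule_lin.
by rewrite lf; [rewrite scalerDr addrACA|exact: KS|exact: KS].
Qed.

Lemma image_plus_subl N K : submodule K -> N `<=` image_plus N f K.
Proof.
move=> sK z Nz; exists z => //; exists 0; first exact: submodule0.
by rewrite linear_on0 addr0.
Qed.

Lemma image_plus_set0 N : image_plus N f [set 0] = N.
Proof.
apply/seteqP; split=> [_ [z Nz [_ -> ->]]|]; first by rewrite linear_on0 addr0.
by apply: image_plus_subl; exact: submodule_set0.
Qed.

Lemma submodule_preimage N : submodule N -> submodule (S `&` f @^-1` N).
Proof.
move=> sN; apply: submoduleI => [|a u v [Su Nu] [Sv Nv]].
  by split=> /=; [exact: submodule0|rewrite linear_on0; exact: submodule0].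
by split=> /=; [exact: submodule_lin|rewrite lf //; exact: submodule_lin].
Qed.

Lemma maximal_image_plus N K K' :
  submodule N -> submodule K' -> K' `<=` S -> maximal_submodule K K' ->
  image_plus N f K = image_plus N f K' \/
  maximal_submodule (image_plus N f K) (image_plus N f K').
Proof.
move=> sN sK' K'S mK; have KK' := maximal_sub mK; case: mK => sK _ mK.
have [e|neq] := pselect (image_plus N f K = image_plus N f K'); [by left|right].
have sub : image_plus N f K `<=` image_plus N f K'.
  by move=> _ [z Nz [x Kx ->]]; exists z => //; exists x => //; exact: KK'.
apply: maximal_submoduleI => //.
  by apply: submodule_image_plus => //; apply: subset_trans K'S.
move=> L sL KL LK' neqL.
have NL : N `<=` L by apply: subset_trans KL; exact: image_plus_subl.
(* The intermediate [L] is pulled back into [K'], where maximality of [K] decides. For preimages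
   below, [L] is pushed forward instead. *)
have [| | |eqK|eqK'] := mK (K' `&` (S `&` f @^-1` L)).
- by apply: submodule_cap => //; exact: submodule_preimage.
- move=> x Kx; split; first exact: KK'.
  split; first exact/K'S/KK'.
  apply: KL; exists 0; first exact: submodule0.
  by exists x => //; rewrite add0r.
- by move=> x [].
- case: neqL; apply/seteqP; split=> // y Ly.
  have [z Nz [x K'x yE]] := LK' _ Ly; exists z => //; exists x => //.
  rewrite -eqK; do 2!split => //=; first exact: K'S.
  have -> : f x = y - z by rewrite yE addrC addKr.
  by apply: submoduleB => //; exact: NL.
- move=> _ [z Nz [x K'x ->]]; apply: submoduleD => //; first exact: NL.
  by move: K'x; rewrite -eqK' => -[_ []].
Qed.

Lemma maximal_preimage N N' : submodule N' -> maximal_submodule N N' ->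
  S `&` f @^-1` N = S `&` f @^-1` N' \/
  maximal_submodule (S `&` f @^-1` N) (S `&` f @^-1` N').
Proof.
move=> sN' mN; have NN' := maximal_sub mN; case: mN => sN _ mN.
have [e|neq] := pselect (S `&` f @^-1` N = S `&` f @^-1` N'); [by left|right].
apply: maximal_submoduleI => //; first exact: submodule_preimage.
  by move=> x [Sx Nx]; split=> //; exact: NN' Nx.
move=> L sL NL LN' neqL.
have LS : L `<=` S by move=> x /LN' [].
have [| | |eqN|eqN'] := mN (image_plus N f L).
- exact: submodule_image_plus.
- exact: image_plus_subl.
- move=> _ [z Nz [x Lx ->]]; apply: submoduleD => //; first exact: NN'.
  by have [] := LN' _ Lx.
- case: neqL; apply/seteqP; split=> // x Lx; split; first exact: LS.
  rewrite /= -eqN; exists 0; first exact: submodule0.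
  by exists x => //; rewrite add0r.
- move=> x [Sx]; rewrite /= -eqN' => -[z Nz [l Ll fx]].
  rewrite -[x](subrK l); apply: submoduleD => //; apply: NL; split.
    by apply: submoduleB => //; exact: LS.
  by rewrite /= linear_onB // ?fx ?addrK //; exact: LS.
Qed.

Lemma maximal_preimage_onto N N' : submodule N' -> maximal_submodule N N' ->
  (forall y, N' y -> exists2 x, S x & f x = y) ->
  maximal_submodule (S `&` f @^-1` N) (S `&` f @^-1` N').
Proof.
move=> sN' mN fS; case: (maximal_preimage sN' mN) => // e.
case: mN => _ [_ []] y N'y; have [x Sx fx] := fS _ N'y; rewrite -fx in N'y *.
suff [] : (S `&` f @^-1` N) x by [].
by rewrite e.
Qed.

End LinearOn.

(** * Jordan-Hoelder: invariance of length *)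

Section Length.
Variables (R : pzRingType) (V : lmodType R).
Implicit Types (N K L X Y : set V).

Lemma linear_on_id N : linear_on N id. Proof. by []. Qed.

Lemma submodule_plus N K :
  submodule N -> submodule K -> submodule (image_plus N id K).
Proof. by move=> sN sK; apply: (submodule_image_plus (submodule_setT V)). Qed.

Lemma maximal_plus N K K' :
  submodule N -> submodule K' -> maximal_submodule K K' ->
  image_plus N id K = image_plus N id K' \/
  maximal_submodule (image_plus N id K) (image_plus N id K').
Proof. by move=> sN sK'; apply: (maximal_image_plus (submodule_setT V)). Qed.

Lemma maximal_capl L N N' :
  submodule N' -> submodule L -> maximal_submodule N N' ->
  L `<=` N' -> ~ L `<=` N -> maximal_submodule (L `&` N) L.
Proof.
move=> sN' sL mN LN' nLN.
have LN'E : L `&` N' = L by apply/setIidPl.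
case: (maximal_preimage sL (@linear_on_id L) sN' mN);
  rewrite !preimage_id LN'E // => /setIidPl //.
Qed.

(** An inequality suffices here. In the inductive step with [L] not inside the penultimate term [N],
    the intersection of [L] and [N] is maximal in [L], and adding [L] to a series from that
    intersection to [N] yields one from [L] to [N'], no longer than before. *)
Lemma series_refine K N n L : series K N n -> submodule L ->
  K `<=` L -> L `<=` N ->
  exists p q, [/\ (p + q <= n)%N, series K L p & series L N q].
Proof.
move=> sKN; elim: sKN L =>
  [{}K sK L sL KL LK|{}K {}N N' {}n sKN IH mN sN' L sL KL LN'].
  have -> : L = K by apply/seteqP.
  by exists 0%N, 0%N; split=> //; exact: series_refl.
have [LN|nLN] := pselect (L `<=` N).
  have [p [q [lepq sKL sLN]]] := IH _ sL KL LN.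
  by exists p, q.+1; split=> //; [rewrite addnS|apply: series_step sLN mN sN'].
have sN := maximal_submoduleP mN.
have mL := maximal_capl sN' sL mN LN' nLN.
have [||p [q [lepq sKI sIN]]] := IH _ (maximal_submoduleP mL).
- by move=> x Kx; split; [exact: KL|exact: series_sub sKN _ Kx].
- exact: subIsetr.
have := series_push (phi := image_plus L id) _ _ sIN.
case=> [X sX|X Y sY _ _ mX|m lemq].
- exact: submodule_plus.
- exact: maximal_plus.
have -> : image_plus L id (L `&` N) = L.
  apply/seteqP; split=> [_ [z Lz [x [Lx _] ->]]|z Lz]; first exact: submoduleD.
  exists z => //; exists 0; last by rewrite addr0.
  by split; exact: submodule0.
have -> : image_plus L id N = N'.
  have sLN : submodule (image_plus L id N).
    by apply: submodule_plus => //; exact: maximal_submoduleP mN.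
  have NLN : N `<=` image_plus L id N.
    by move=> x Nx; exists 0; [exact: submodule0|exists x => //; rewrite add0r].
  have LLN : L `<=` image_plus L id N.
    by move=> x Lx; exists x => //; exists 0; [exact: submodule0|rewrite addr0].
  case: (mN) => _ _ /(_ _ sLN NLN) [_ [z Lz [x Nx ->]]|eqN|//].
    apply: submoduleD => //; first exact: LN'.
    exact: maximal_sub mN _ Nx.
  by case: nLN; rewrite -eqN.
move=> sLN'; exists p.+1, m; split=> //.
  by rewrite addSn ltnS; apply: leq_trans lepq; rewrite leq_add2l.
exact: series_step sKI mL sL.
Qed.

(** Inserting the penultimate term of one series into the other leaves at least one step above it;
    induction bounds the part below. *)
Lemma series_leq K N m n : series K N m -> series K N n -> (m <= n)%N.
Proof.
move=> sKN; elim: sKN n => // {}K {}N N' {}m sKN IH mN sN' n sKN'.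
have [|||p [q [lepq /IH lemp sNN']]] := series_refine sKN' (L := N).
- exact: maximal_submoduleP mN.
- exact: series_sub sKN.
- exact: maximal_sub mN.
case: q sNN' lepq => [sNN'|q _].
  by inversion sNN'; subst; case: (maximal_neq mN).
by rewrite addnS => /(leq_ltn_trans (leq_addr q p)); apply: leq_ltn_trans.
Qed.

Lemma series_uniq K N m n : series K N m -> series K N n -> m = n.
Proof.
by move=> sm sn; apply/eqP; rewrite eqn_leq !(series_leq sm, series_leq sn).
Qed.

Lemma module_lengthE n : series [set 0] [set: V] n -> module_length V = n.
Proof.
have cseries s : @composition_series R V s -> series [set 0] [set: V] (size s).
  case=> ps ls; apply: series_path;
    [exact: submodule_setT| |exact: submodule_set0].
  by exists s.
move=> sn; rewrite /module_length; apply: xget_subset1 => /=.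
  by have [s [ps ls szs]] := series_pathE sn; exists s.
move=> _ _ [s /cseries cs <-] [s' /cseries cs' <-]; exact: series_uniq cs cs'.
Qed.

Lemma finite_lengthP : finite_length V <-> exists s, @composition_series R V s.
Proof.
split=> [[n /series_pathE [s [ps ls _]]]|[s [ps ls]]]; first by exists s.
exists (size s); apply: series_path;
  [exact: submodule_setT| |exact: submodule_set0].
by exists s.
Qed.

Lemma module_lengthP :
  finite_length V -> series [set 0] [set: V] (module_length V).
Proof. by case=> n sn; rewrite (module_lengthE sn). Qed.

Lemma finite_length_between K N :
  finite_length V -> submodule K -> submodule N ->
  K `<=` N -> exists n, series K N n.
Proof.
case=> n sV sK sN KN.
have [p [q [_ sK' _]]] :=
  series_refine sV sN (sub0_submodule sN) (@subsetT _ _).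
have [p' [q' [_ _ sKN]]] := series_refine sK' sK (sub0_submodule sK) KN.
by exists q'.
Qed.

Lemma exists_maximal K N : finite_length V -> submodule K -> submodule N ->
  K `<=` N -> K <> N -> exists2 M, maximal_submodule M N & K `<=` M.
Proof.
move=> fV sK sN KN neq; have [n sKN] := finite_length_between fV sK sN KN.
have [M mM sKM] := series_last sKN neq; exists M => //; exact: series_sub sKM.
Qed.

End Length.

(** Each maximal step costs one generator, any element outside the smaller term. [K = [set 0]] is a
    separate premise so that induction on [series] has a variable index. *)
Lemma series_generators (R : pzRingType) (V : lmodType R) (K N : set V) n :
  series K N n -> K = [set 0] -> exists e : 'I_n -> V, forall v, N v ->
    exists c : 'I_n -> R, v = \sum_(i < n) c i *: e i.
Proof.
elim=> [{}K _ ->|{}K {}N N' {}n sKN IH mN sN' /IH[e eP]].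
  by exists (fun=> 0) => v ->; exists (fun=> 0); rewrite big_ord0.
have [x N'x nNx] : exists2 x, N' x & ~ N x.
  apply: contrapT => nx; case: (mN) => _ [_ []] x N'x.
  by apply: contrapT => nNx; apply: nx; exists x.
have sN := maximal_submoduleP mN; have NN' := maximal_sub mN.
exists (fun i => if unlift ord_max i is Some j then e j else x) => v N'v.
have sR := submodule_setT R^o.
pose f (a : R^o) : V := (a : R) *: x.
have lf : linear_on setT f by move=> a u w _ _; rewrite /f scalerDl scalerA.
have [| | |NE|N'E] := (fun '(And3 _ _ h) => h) mN (image_plus N f setT).
- by apply: (submodule_image_plus sR lf).
- exact: (image_plus_subl sR lf sR).
- move=> _ [z Nz [a _ ->]]; apply: submoduleD => //; first exact: NN'.
  exact: submoduleZ.
- case: nNx; rewrite -NE; exists 0; first exact: submodule0.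
  by exists (1 : R) => //; rewrite /f scale1r add0r.
move: N'v; rewrite -N'E => -[z Nz [a _ ->]]; have [c ->] := eP _ Nz.
exists (fun i => if unlift ord_max i is Some j then c j else a).
rewrite big_ord_recr /= unlift_none; congr (_ + _); apply: eq_bigr => i _.
have -> : widen_ord (leqnSn n) i = lift ord_max i by apply/val_inj;
  rewrite /= /bump leqNgt ltn_ord.
by rewrite liftK.
Qed.

Lemma finite_length_finitely_generated (R : pzRingType) (V : lmodType R) :
  finite_length V -> finitely_generated V.
Proof.
case=> n /series_generators/(_ erefl)[e eP].
by exists n, e => v; exact: eP.
Qed.

(** * Finite length over artin algebras *)

Lemma artinian_min (R : pzRingType) (V : lmodType R)
    (F : set (set V)) (N0 : set V) :
  artinian_module V -> (forall N, F N -> submodule N) -> F N0 ->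
  exists2 N, F N & forall N', F N' -> N' `<=` N -> N' = N.
Proof.
move=> artV sF FN0; apply: contrapT => nomin.
have smaller N : exists N', F N -> F N' /\ N' `<` N.
  have [FN|nFN] := pselect (F N); last by exists N.
  apply: contrapT => noN'; apply: nomin; exists N => // N' FN' N'N.
  apply/seteqP; split=> //; apply: contrapT => nNN'.
  by apply: noN'; exists N'.
have [g gP] := choice smaller.
have Fg i : F (iter i g N0) by elim: i => //= i /gP[].
have [|i|n /(_ n.+1 (leqnSn n)) /= gn] := artV (fun i => iter i g N0).
- by move=> i; exact: sF.
- by move=> x; case: (gP _ (Fg i)) => _ [+ _]; apply.
- by case: (gP _ (Fg n)) => _ [_ []]; rewrite gn.
Qed.

(* Under the dichotomy I is a vector space over the field R / ann I, and a
   submodule of I maximal among those avoiding a given nonzero x0 is a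
   hyperplane. *)
Lemma divisible_ideal_maximal (R : comPzRingType) (I : set R^o) :
  artinian_module R^o -> submodule I -> I <> [set 0] ->
  (forall r : R, (forall x, I x -> r * x = 0) \/
     (forall y, I y -> exists2 x, I x & y = r * x)) ->
  exists H, maximal_submodule H I.
Proof.
move=> artR sI I0 dich.
have inv (r : R) x : I x -> r * x <> 0 ->
    exists s, forall y, I y -> s * (r * y) = y.
  move=> Ix rx0; case: (dich r) => [/(_ _ Ix)//|onto].
  have ontoX n y : I y -> exists2 z, I z & y = r ^+ n * z.
    elim: n y => [|n IH] y Iy; first by exists y => //; rewrite expr0 mul1r.
    have [z Iz ->] := IH _ Iy; have [w Iw ->] := onto _ Iz.
    by exists w => //; rewrite exprSr mulrA.
  (* The ideals generated by powers of [r] stabilise, so r^n = r^(n+1) s for some [s]; every element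
     of [I] has the form r^n z, hence [s] inverts [r] on [I]. *)
  have [n|n y /= [a ->]|n] := artR (fun n =>
    [set y : R^o | exists a : R, y = r ^+ n * a]).
  - apply: submoduleI => [|a u v [b ->] [c ->]]; first by exists 0;
      rewrite mulr0.
    exists (a * b + c); rewrite mulrDr; congr (_ + _).
    by rewrite /GRing.scale /= mulrCA.
  - by exists (r * a); rewrite exprSr mulrA.
  move=> /(_ n.+1 (leqnSn n)) /= /seteqP[_ /(_ (r ^+ n))][|s rs].
    by exists 1; rewrite mulr1.
  exists s => y Iy; have [z Iz ->] := ontoX n _ Iy.
  by rewrite mulrA mulrA -[s * r * _]mulrA -exprS [s * _]mulrC -rs.
have [x0 Ix0 x0n0] : exists2 x, I x & x <> 0.
  apply: contrapT => nI; apply: I0; apply/seteqP; split=> [x Ix|];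
    last exact: sub0_submodule.
  by apply: contrapT => xn0; apply: nI; exists x.
(* Membership of 0 is left out because Zorn's lemma also takes the empty chain, whose union is
   empty; it is recovered for the maximal [H] afterwards. *)
pose lin_closed (H : set R^o) := forall a u v, H u -> H v -> H (a *: u + v).
have [F /= FP totF|H [[HI nHx0 linH] maxH]] :=
    @Zorn_bigcup _ [set H | [/\ H `<=` I, ~ H x0 & lin_closed H]].
  split=> [x [X /FP[XI _ _]]|[X /FP[_ nX _]] //|]; first exact: XI.
  move=> a u v [X FX Xu] [Y FY Yv].
  have [_ _ linX] := FP _ FX; have [_ _ linY] := FP _ FY.
  case: (totF _ _ FX FY) => sub.
    by exists Y => //; apply: linY => //; exact: sub.
  by exists X => //; apply: linX => //; exact: sub.
have H0 : H 0.
  apply: contrapT => nH0.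
  have Hnone x : ~ H x.
    by move=> Hx; apply: nH0; rewrite -(addNr x) -scaleN1r; exact: linH.
  apply: (maxH [set 0]).
    by split=> [x /Hnone //|H0]; apply: nH0; exact: H0.
  split; [exact: sub0_submodule|by move=> x00; apply: x0n0|].
  by move=> a u v -> ->; rewrite scaler0 addr0.
have sH : submodule H by exact: submoduleI.
exists H; apply: maximal_submoduleI => //; first by move=> eHI; apply: nHx0;
  rewrite eHI.
move=> L sL HL LI neqL.
have Lx0 : L x0.
  apply: contrapT => nLx0; apply: (maxH L).
    by split=> // LH; apply: neqL; apply/seteqP.
  by split=> // a u v; exact: submodule_lin.
move=> z Iz; have [Hz|nHz] := pselect (H z); first exact: HL.
(* Otherwise the span of [z] and [H] would be larger and still avoid [x0]. As [a * z] is nonzero,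
   [a] can be inverted on [I], and [z] is recovered from [x0 - h]. *)
have [h Hh [a x0E]] : exists2 h, H h & exists a, x0 = a * z + h.
  apply: contrapT => nx0.
  apply: (maxH [set y | exists2 h, H h & exists a, y = a * z + h]).
    split=> [y Hy|/(_ z) Hz]; first by exists y => //; exists 0;
      rewrite mul0r add0r.
    by apply: nHz; apply: Hz; exists 0 => //; exists 1; rewrite mul1r addr0.
  split=> // [_ [h Hh [a ->]]|b _ _ [h Hh [a ->]] [h' Hh' [a' ->]]].
    by apply: submoduleD => //; [exact: (submoduleZ a sI)|exact: HI].
  exists (b *: h + h'); first exact: linH.
  by exists (b * a + a'); rewrite scalerDr mulrDl addrACA -mulrA.
have [s sK] : exists s, forall y, I y -> s * (a * y) = y.
  by apply: (inv a z) => // az0; apply: nHx0; rewrite x0E az0 add0r.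
rewrite -(sK _ Iz); have -> : a * z = x0 - h by rewrite x0E addrK.
by apply: (submoduleZ s sL); apply: submoduleB => //; exact: HL.
Qed.

(* For I minimal among the ideals of infinite length and r in R, one of r I
   and I `&` ann r has infinite length, hence equals I. *)
Lemma finite_length_ring (R : comPzRingType) :
  artinian_module R^o -> finite_length R^o.
Proof.
move=> artR; pose fin (I : set R^o) := exists n, series [set 0] I n.
have s0 := submodule_set0 R^o; have sT := submodule_setT R^o.
apply: contrapT => ninf.
have [I [sI nfI] minI] : exists2 I, submodule I /\ ~ fin I &
    forall I', submodule I' /\ ~ fin I' -> I' `<=` I -> I' = I.
  by apply: (@artinian_min _ _ _ setT artR) => // N [].
have finI J : submodule J -> J `<=` I -> J <> I -> fin J.
  by move=> sJ JI neq; apply: contrapT => nfJ; apply: neq; exact: minI.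
have I0 : I <> [set 0].
  by move=> I0; apply: nfI; exists 0%N; rewrite I0; exact: series_refl.
have lin (r : R) : linear_on I (fun x : R^o => r * x : R^o).
  by move=> a u v _ _; rewrite mulrDr; congr (_ + _);
    rewrite /GRing.scale /= mulrCA.
have [r|H mH] := @divisible_ideal_maximal R I artR sI I0.
  pose f := fun x : R^o => r * x : R^o.
  pose rI := image_plus [set 0] f I; pose ker := I `&` f @^-1` [set 0].
  have srI : submodule rI by apply: (submodule_image_plus sI (lin r)).
  have sker : submodule ker by apply: (submodule_preimage sI (lin r)).
  have rII : rI `<=` I.
    by move=> _ [_ -> [x Ix ->]]; rewrite add0r; exact: (submoduleZ r sI).
  have [rIE|neqr] := pselect (rI = I).
    right=> y; rewrite -[in I y]rIE => -[_ -> [x Ix ->]].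
    by exists x => //; rewrite add0r.
  left; apply: contrapT => nker.
  have [n sn] := finI _ srI rII neqr.
  have [m sm] : fin ker.
    apply: finI => //; first exact: subIsetl.
    move=> kerE; apply: nker => x; rewrite -[in I x]kerE => -[] //.
  apply: nfI.
  have [k _] : exists2 k, (k <= n)%N &
      series (I `&` f @^-1` [set 0]) (I `&` f @^-1` rI) k.
    apply: (series_push (phi := fun X => I `&` f @^-1` X)) sn =>
      [X sX|X Y sY _ _ mX].
      exact: (submodule_preimage sI (lin r)).
    exact: (maximal_preimage sI (lin r)).
  have -> : I `&` f @^-1` rI = I.
    apply/setIidPl => x Ix; exists 0 => //; exists x => //; by rewrite add0r.
  by move=> sk; exists (m + k)%N; exact: series_trans sm sk.
(* The chain condition is used again, on submodules of [I] of finite colength. A minimal [N] is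
   either [I], against the existence of [H], or of finite length, which makes [I] of finite
   length. *)
have [N [sN NI [n sNI]] minN] : exists2 N,
    [/\ submodule N, N `<=` I & exists n, series N I n] &
    forall N', [/\ submodule N', N' `<=` I & exists n, series N' I n] ->
      N' `<=` N -> N' = N.
  apply: (@artinian_min _ _ _ I artR) => [N []//|].
  by split=> //; exists 0%N; exact: series_refl.
have [NE|neqN] := pselect (N = I).
  have sH := maximal_submoduleP mH; have HI := maximal_sub mH.
  case: (maximal_neq mH); rewrite -[RHS]NE; apply: minN.
    by split=> //; exists 1%N; exact: series1.
  by rewrite NE.
have [m sm] := finI _ sN NI neqN.
by apply: nfI; exists (m + n)%N; exact: series_trans sm sNI.
Qed.

(** Each generator adjoins an image of the ring, so the length grows by at most that of [R^o]. *)
Lemma finite_length_fg (R : pzRingType) (V : lmodType R) :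
  finite_length R^o -> finitely_generated V -> finite_length V.
Proof.
case=> l sR [n [e eP]].
suff [m sm] : exists m, series [set 0]
    [set v | exists c : 'I_n -> R, v = \sum_(i < n) c i *: e i] m.
  by exists m; congr (series _ _ m): sm; apply/seteqP; split=> // v _;
    exact: eP.
elim: n e {eP} => [|n IH] e.
  exists 0%N; have -> :
      [set v | exists c : 'I_0 -> R, v = \sum_(i < 0) c i *: e i] = [set 0].
    apply/seteqP; split=> [v [c ->]|v ->]; first by rewrite big_ord0.
    by exists (fun=> 0); rewrite big_ord0.
  by apply: series_refl; exact: submodule_set0.
have [m] := IH (fun i => e (widen_ord (leqnSn n) i));
  set N := [set v | _] => sm.
have sN := series_submodr sm.
pose f (a : R^o) : V := (a : R) *: e ord_max.
have lf : linear_on setT f by move=> a u v _ _; rewrite /f scalerDl scalerA.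
have [k _ sk] := series_push (phi := image_plus N f)
  (fun X sX => submodule_image_plus (submodule_setT _) lf sN sX (@subsetT _ _))
  (fun X Y sY _ _ mX => maximal_image_plus (submodule_setT _) lf sN sY
    (@subsetT _ _) mX) sR.
rewrite (image_plus_set0 (submodule_setT _) lf) in sk.
exists (m + k)%N; have := series_trans sm sk; congr (series _ _ _).
apply/seteqP; split=> [_ [_ [c ->] [a _ ->]]|v [c ->]].
  exists (fun i => if unlift ord_max i is Some j then c j else a).
  rewrite big_ord_recr /= unlift_none; congr (_ + _); apply: eq_bigr => i _.
  have -> : widen_ord (leqnSn n) i = lift ord_max i by apply/val_inj;
    rewrite /= /bump leqNgt ltn_ord.
  by rewrite liftK.
rewrite big_ord_recr /=.
exists (\sum_(i < n) c (widen_ord (leqnSn n) i) *: e (widen_ord (leqnSn n) i)).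
  by exists (fun i => c (widen_ord (leqnSn n) i)).
by exists (c ord_max).
Qed.

(** * Restriction of scalars to the base ring *)

Section RestrictScalars.
Variables (R : comPzRingType) (A : algType R) (M : lmodType A^c).

Definition restrict_scalars : Type := M.

HB.instance Definition _ := GRing.Zmodule.on restrict_scalars.

Definition restrict_scale (r : R) (v : restrict_scalars) : restrict_scalars :=
  (r%:A : A^c) *: (v : M).

Fact restrict_scalerA r s v :
  restrict_scale r (restrict_scale s v) = restrict_scale (r * s) v.
Proof.
rewrite /restrict_scale scalerA; congr (_ *: _).
by change (s%:A * r%:A = (r * s)%:A :> A); rewrite mulr_algl scalerA mulrC.
Qed.

Fact restrict_scale1r : left_id 1 restrict_scale.
Proof. by move=> v; rewrite /restrict_scale scale1r; exact: scale1r. Qed.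

Fact restrict_scalerDr : right_distributive restrict_scale +%R.
Proof. by move=> r u v; exact: scalerDr. Qed.

Fact restrict_scalerDl v : {morph restrict_scale^~ v : r s / r + s}.
Proof. by move=> r s; rewrite /restrict_scale scalerDl; exact: scalerDl. Qed.

HB.instance Definition _ := GRing.Zmodule_isLmodule.Build R restrict_scalars
  restrict_scalerA restrict_scale1r restrict_scalerDr restrict_scalerDl.

Lemma submodule_restrict (N : set M) :
  submodule N -> submodule (N : set restrict_scalars).
Proof.
move=> sN; apply: submoduleI => [|r u v Nu Nv]; first exact: submodule0 sN.
exact: (submodule_lin (r%:A : A^c) sN Nu Nv).
Qed.

Lemma finitely_generated_restrict :
  finitely_generated A -> finitely_generated M ->
  finitely_generated restrict_scalars.
Proof.
move=> [m [a aP]] [n [e eP]].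
pose E (k : 'I_n * 'I_m) : restrict_scalars := (a k.2 : A^c) *: e k.1.
suff EP v : exists c : 'I_n * 'I_m -> R, v = \sum_k c k *: E k.
  exists #|{: 'I_n * 'I_m}|, (fun i => E (enum_val i)) => v.
  have [c ->] := EP v; exists (fun i => c (enum_val i)).
  by rewrite -(big_enum_val (fun k => c k *: E k)); apply: eq_bigl.
have [c ->] := eP v; have [d dP] := choice (fun i => aP (c i)).
exists (fun k => d k.1 k.2).
rewrite -(pair_bigA _ (fun i j => d i j *: E (i, j))) /=.
apply: eq_bigr => i _; rewrite {1}dP.
have -> : \sum_(j < m) d i j *: a j =
  \sum_(j < m) (d i j *: a j : A^c) :> A^c by [].
rewrite scaler_suml; apply: eq_bigr => j _.
change ((d i j *: a j : A^c) *: e i =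
  ((d i j)%:A : A^c) *: ((a j : A^c) *: e i)).
rewrite scalerA; congr (_ *: _).
by change (d i j *: a j = a j * (d i j)%:A :> A); rewrite mulr_algr.
Qed.

End RestrictScalars.

(** A simple module over the algebra need not be simple over the base ring, so series do not
    transfer. A strictly monotone rank, to be the length over the base ring, bounds chains instead;
    the induction is on the rank gap. *)
Lemma finite_length_rank (S : pzRingType) (M : lmodType S) (rk : set M -> nat) :
  (forall K N, submodule K -> submodule N -> K `<` N -> (rk K < rk N)%N) ->
  finite_length M.
Proof.
move=> rkP; suff step n : forall K N, submodule K -> submodule N -> K `<=` N ->
    (rk N - rk K < n)%N -> exists m, series K N m.
  apply: (step _ _ _ (submodule_set0 M) (submodule_setT M) (@subsetT _ _)).
  exact: ltnSn.
elim: n => // n IH K N sK sN KN ltn.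
have [eKN|neq] := pselect (K = N).
  by exists 0%N; rewrite -eKN; exact: series_refl.
have [mK|nmK] := pselect (maximal_submodule K N).
  by exists 1%N; exact: series1.
have [L [sL KL LN]] : exists L, [/\ submodule L, K `<` L & L `<` N].
  apply: contrapT => noL; apply: nmK; apply: maximal_submoduleI => //.
  move=> L sL KL LN neqL; apply: contrapT => nNL; apply: noL; exists L.
  split=> //; split=> // LK; apply: neqL; exact/seteqP.
have ltKL := rkP _ _ sK sL KL; have ltLN := rkP _ _ sL sN LN.
case: KL => KL _; case: LN => LN _.
have ltKN := ltn_trans ltKL ltLN.
have [|p sp] := IH K L sK sL KL.
  by rewrite -ltnS; apply: leq_trans ltn; rewrite ltnS ltn_sub2r.
have [|q sq] := IH L N sL sN LN.
  by rewrite -ltnS; apply: leq_trans ltn; rewrite ltnS ltn_sub2l.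
by exists (p + q)%N; exact: series_trans sp sq.
Qed.

Lemma finite_length_artin_algebra (R : comPzRingType) (A : algType R)
    (M : lmodType A^c) :
  artin_algebra A -> finitely_generated M -> finite_length M.
Proof.
case=> artR fgA fgM; have fV := finite_length_fg (finite_length_ring artR)
  (finitely_generated_restrict fgA fgM).
pose V := restrict_scalars M.
(* The default of [xget] does no harm: every submodule has a series over [R]. *)
apply: (@finite_length_rank _ _ (fun N : set M =>
  xget 0%N [set n | series [set 0] (N : set V) n])).
move=> K N /submodule_restrict sK /submodule_restrict sN [KN nNK].
have s0 := submodule_set0 V.
have [k sk] := finite_length_between fV s0 sK (sub0_submodule sK).
have [n sn] := finite_length_between fV sK sN KN.
have rkE (N' : set M) l : series [set 0] (N' : set V) l ->
    xget 0%N [set n | series [set 0] (N' : set V) n] = l.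
  by move=> sl; apply: xget_subset1 => // x y sx sy; exact: series_uniq sx sy.
rewrite (rkE _ _ sk) (rkE _ _ (series_trans sk sn)).
case: n sn => [sn|n _]; last by rewrite addnS ltnS leq_addr.
by inversion sn; subst; case: nNK.
Qed.

(** * Uniserial modules and radical layers *)

(** Uniseriality of the quotient by [N], up to finite length, phrased without forming it. *)
Definition comparable_above (R : pzRingType) (V : lmodType R)
    (N : set V) : Prop :=
  forall X Y : set V, submodule X -> submodule Y -> N `<=` X -> N `<=` Y ->
    X `<=` Y \/ Y `<=` X.

Lemma uniserialP (R : pzRingType) (V : lmodType R) :
  uniserial V <-> finite_length V /\ comparable_above [set 0 : V].
Proof.
split=> [[s [cs us]]|[/finite_lengthP[s cs] cmp]].
  have fV : finite_length V by apply/finite_lengthP; exists s.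
  split=> // X Y sX sY _ _.
  (* Refining at [Z] gives a composition series through [Z]; by uniqueness it is [s], so every
     submodule is a term of [s]. *)
  have split_at Z : submodule Z -> exists n, last [set 0] (take n s) = Z.
    move=> sZ; case: (fV) => l sl.
    have [p [q [_ /series_pathE[s1 [ps1 ls1 _]]
        /series_pathE[s2 [ps2 ls2 _]]]]] :=
      series_refine sl sZ (sub0_submodule sZ) (@subsetT _ _).
    exists (size s1); rewrite (us (s1 ++ s2)) ?take_size_cat //.
    by split; [rewrite cat_path ps1 ls1|rewrite last_cat ls1].
  have mono m n : (m <= n)%N ->
      last [set 0] (take m s) `<=` last [set 0] (take n s).
    move=> lemn; have sE := cat_take_drop m (take n s).
    rewrite take_takel // in sE.
    have : path (fun K N => `[< maximal_submodule K N >]) [set 0] (take n s).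
      by case: cs => ps _; move: ps;
        rewrite -{1}(cat_take_drop n s) cat_path => /andP[].
    rewrite -{}sE cat_path last_cat => /andP[_].
    elim: (drop m _) (last _ _) => [K _ //|N r IH K /= /andP[/asboolP mN /IH]].
    by apply: subset_trans; exact: maximal_sub mN.
  have [m <-] := split_at _ sX; have [n <-] := split_at _ sY.
  by case: (leqP m n) => [|/ltnW] /mono; [left|right].
exists s; split=> // s' cs'.
have s0 := submodule_set0 V.
case: cs cs' => ps ls [ps' ls'].
(* The bottom is generalised from 0 to [K]. The next terms of the two series are comparable and [K]
   is maximal in both, so they coincide. *)
elim: s s' [set 0] s0 cmp ps ls ps' ls' => [|N s IH] [|N' s'] K sK cmp //=.
- move=> _ KT /andP[/asboolP mN' _] _; case: (mN') => _ [_ []].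
  by rewrite KT; exact: subsetT.
- move=> /andP[/asboolP mN _] _ _ KT; case: (mN) => _ [_ []].
  by rewrite KT; exact: subsetT.
move=> /andP[/asboolP mN ps] ls /andP[/asboolP mN' ps'] ls'.
have sub L r : path (fun K N => `[< maximal_submodule K N >]) L r ->
    last L r = [set: V] -> submodule L.
  case: r => [_ /= ->|N'' r /= /andP[/asboolP[]]] //; exact: submodule_setT.
have sN := sub _ _ ps ls; have sN' := sub _ _ ps' ls'.
have KN := maximal_sub mN; have KN' := maximal_sub mN'.
have NE : N = N'.
  case: (cmp _ _ sN sN' KN KN') => NN'.
    have [_ _ /(_ _ sN KN NN') [NK|//]] := mN'.
    by case: (maximal_neq mN).
  have [_ _ /(_ _ sN' KN' NN') [NK|//]] := mN.
  by case: (maximal_neq mN').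
subst N'; congr (_ :: _); apply: (IH _ N) => // X Y sX sY NX NY.
by apply: cmp => //; exact: subset_trans KN _.
Qed.

Section Quotient.
Variables (R : pzRingType) (V : lmodType R) (N : set V) (HN : submodule N).
Let Q : lmodType R := quotient_module HN.

Lemma quotient_pi_linear (S : set V) :
  linear_on S (\pi_(quotient_module HN) : V -> Q).
Proof.
move=> a u v _ _; rewrite quotient_piD; congr (_ + _).
exact/esym/quotient_scale_pi.
Qed.

Lemma quotient_pi_eq0 x : (\pi_(quotient_module HN) x : Q) = 0 <-> N x.
Proof.
have sT := submodule_setT V.
rewrite -(linear_on0 sT (@quotient_pi_linear setT)).
split=> [/quotient_eqP|Nx]; first by rewrite subr0 /submodule_pred inE.
by apply/quotient_eqP; rewrite subr0 /submodule_pred inE.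
Qed.

Lemma quotient_pi_onto (y : Q) : exists x, (\pi_(quotient_module HN) x : Q) = y.
Proof. by exists (repr y); rewrite reprK. Qed.

End Quotient.

Lemma uniserial_quotient (R : pzRingType) (V : lmodType R) (N : set V)
    (HN : submodule N) : finite_length V ->
  uniserial (quotient_module HN) <-> comparable_above N.
Proof.
move=> [l sl]; pose p : V -> quotient_module HN := \pi_(quotient_module HN).
have sT := submodule_setT V.
have lp : linear_on setT p by exact: quotient_pi_linear.
have s0 := submodule_set0 (quotient_module HN).
rewrite uniserialP; split=> [[_ cmp] X Y sX sY NX NY|cmp].
  have sub_image Z W : submodule W -> N `<=` W ->
      image_plus [set 0] p Z `<=` image_plus [set 0] p W -> Z `<=` W.
    move=> sW NW ZW x Zx.
    have [|_ -> [y Wy]] := ZW (p x); first by exists 0 => //; exists x;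
      rewrite ?add0r.
    rewrite add0r => pxy; rewrite -[x](subrK y); apply: submoduleD => //.
    have pxy0 : p (x - y) = 0 by rewrite (linear_onB sT lp) // pxy subrr.
    exact/NW/(quotient_pi_eq0 HN).
  have simg Z (sZ : submodule Z) : submodule (image_plus [set 0] p Z).
    by apply: (submodule_image_plus sT lp).
  case: (cmp _ _ (simg _ sX) (simg _ sY)).
  - exact: sub0_submodule (simg _ sX).
  - exact: sub0_submodule (simg _ sY).
  - by move/sub_image; left; auto.
  - by move/sub_image; right; auto.
split.
  have [k _ sk] := series_push (phi := image_plus [set 0] p)
    (fun X sX => submodule_image_plus sT lp s0 sX (@subsetT _ _))
    (fun X Y sY _ _ mX => maximal_image_plus sT lp s0 sY (@subsetT _ _) mX) sl.
  rewrite (image_plus_set0 sT lp) in sk.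
  exists k; congr (series _ _ _): sk; apply/seteqP; split=> // y _.
  by have [x <-] := quotient_pi_onto y; exists 0 => //; exists x;
    rewrite ?add0r.
move=> X Y sX sY _ _.
have spre Z (sZ : submodule Z) : submodule (setT `&` p @^-1` Z).
  by apply: (submodule_preimage sT lp).
have Npre Z (sZ : submodule Z) : N `<=` setT `&` p @^-1` Z.
  by move=> x /(quotient_pi_eq0 HN) px; split=> //=; rewrite /p px;
    exact: submodule0.
case: (cmp _ _ (spre _ sX) (spre _ sY) (Npre _ sX) (Npre _ sY)) => XY;
  [left|right]; move=> y; have [x <-] := quotient_pi_onto y => Zx;
  by have [] := XY x (conj I Zx).
Qed.

Section RadicalLayers.
Variables (R : pzRingType) (V : lmodType R).
Implicit Types (N K X : set V).

Lemma rad_sub N : rad N `<=` N.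
Proof. by move=> x []. Qed.

Lemma rad_sub_maximal K N : maximal_submodule K N -> rad N `<=` K.
Proof. by move=> mK x [_]; apply. Qed.

Lemma radn_sub m n : (m <= n)%N -> radn V n `<=` radn V m.
Proof.
elim: n => [|n IH]; first by rewrite leqn0 => /eqP->.
rewrite leq_eqVlt => /predU1P[->//|]; rewrite ltnS => /IH.
by apply: subset_trans; exact: rad_sub.
Qed.

Lemma rad_neq N : finite_length V -> submodule N -> N <> [set 0] -> rad N <> N.
Proof.
move=> fV sN N0 radN.
have [|K mK _] := exists_maximal fV (submodule_set0 V) sN (sub0_submodule sN).
  exact: nesym.
case: (mK) => _ [_ []]; rewrite -radN; exact: rad_sub_maximal.
Qed.

(* For V of finite length: the j-th radical layer is simple or zero. *)
Definition radn_step j := forall X, submodule X -> X `<=` radn V j ->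
  X = radn V j \/ X `<=` radn V j.+1.

Lemma radn_step_dichotomy t X : (forall j, (j < t)%N -> radn_step j) ->
  submodule X -> X `<=` radn V t \/ exists2 j, (j < t)%N & X = radn V j.
Proof.
move=> + sX; elim: t => [_|t IH step]; first by left; exact: subsetT.
have [j ltjt|XW|[j ltjt ->]] := IH.
- by apply: step; exact: leqW.
- case: (step t (ltnSn t) X sX XW) => [->|]; last by left.
  by right; exists t.
- by right; exists j => //; exact: leqW.
Qed.

(** For [j < t] every maximal submodule of [radn V j] contains [radn V t], so in a chain there is
    only one; a proper submodule lies in it, hence in the next radical. Conversely, simple layers
    leave only radicals above [radn V t]. *)
Lemma comparable_above_radn t : finite_length V ->
  comparable_above (radn V t) <-> forall j, (j < t)%N -> radn_step j.
Proof.
move=> fV; split=> [cmp j ltjt X sX XW|step X Y sX sY WX WY].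
  have sW := submodule_radn V j.
  have [->|neq] := pselect (X = radn V j); [by left|right].
  have [K mK XK] := exists_maximal fV sX sW XW neq.
  have above L : maximal_submodule L (radn V j) -> radn V t `<=` L.
    by move=> mL; apply: subset_trans (rad_sub_maximal mL);
      exact: radn_sub ltjt.
  move=> x Xx; split=> [|L mL]; first exact: XW.
  have [sK _ maxK] := mK; have [sL _ maxL] := mL.
  case: (cmp _ _ sK sL (above _ mK) (above _ mL)) => KL; first exact/KL/XK.
  have [<-|eK] := maxL _ sK KL (maximal_sub mK); first exact: XK.
  by case: (maximal_neq mK).
have israd Z : submodule Z -> radn V t `<=` Z -> exists j, Z = radn V j.
  move=> sZ WZ; case: (radn_step_dichotomy step sZ) => [ZW|[j _ ->]];
    last by exists j.
  by exists t; apply/seteqP.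
have [m ->] := israd _ sX WX; have [n ->] := israd _ sY WY.
by case: (leqP m n) => [|/ltnW] /radn_sub; [right|left].
Qed.

(** Each radical loses at least one composition factor until zero is reached, so the radical of
    index [module_length V] vanishes. *)
Lemma radn_length j : finite_length V ->
  exists2 m, (m <= module_length V - j)%N & series [set 0] (radn V j) m.
Proof.
move=> fV; elim: j => [|j [m lem sm]].
  by exists (module_length V); [rewrite subn0|exact: module_lengthP].
have sW := submodule_radn V j.+1.
have WW : radn V j.+1 `<=` radn V j by exact: rad_sub.
have [W0|W0] := pselect (radn V j = [set 0]).
  exists 0%N => //; have -> : radn V j.+1 = [set 0].
    by apply/seteqP; split; [rewrite -W0|exact: sub0_submodule].
  exact: series_refl (submodule_set0 V).
have [p [q [lepq sp sq]]] := series_refine sm sW (sub0_submodule sW) WW.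
exists p => //; case: q sq lepq => [sq|q _].
  by inversion sq; case: (rad_neq fV (submodule_radn V j) W0).
move=> lepq; rewrite subnS -ltnS; apply: leq_trans (leqSpred _).
by apply: leq_trans lem; apply: leq_trans lepq; rewrite addnS ltnS leq_addr.
Qed.

Lemma radn_module_length : finite_length V -> radn V (module_length V) = [set
  0].
Proof.
move=> /(radn_length (module_length V))[m]; rewrite subnn leqn0 => /eqP-> s0.
by inversion s0.
Qed.

Lemma uniserial_quot_radn t : finite_length V ->
  uniserial (quot_radn V t) <-> forall j, (j < t)%N -> radn_step j.
Proof.
by move=> fV; rewrite -comparable_above_radn //; exact: uniserial_quotient.
Qed.

Lemma uniserial_radn : finite_length V ->
  uniserial V <-> forall j, (j < module_length V)%N -> radn_step j.
Proof.
move=> fV; rewrite uniserialP -comparable_above_radn // radn_module_length //.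
by split=> [[]|].
Qed.

(** The index is [l - s], where [s] is the first layer failing [radn_step]; uniseriality of the
    given quotient means [t <= s]. *)
Lemma factor_serial_exists t : finite_length V -> ~ uniserial V ->
  uniserial (quot_radn V t) ->
  exists2 i, (1 < i <= module_length V - t)%N & factor_serial V i.
Proof.
move=> fV nuV /(uniserial_quot_radn _ fV) step.
set l := module_length V.
have [s /asboolP nstep mins] : exists2 s, `[< ~ radn_step s >] &
    forall j, (j < s)%N -> radn_step j.
  have ex : exists s, `[< ~ radn_step s >].
    apply: contrapT => nos; apply/nuV/uniserial_radn => // j _.
    by apply: contrapT => nj; apply: nos; exists j; exact/asboolP.
  case: (ex_minnP ex) => s ns mins; exists s => // j ltjs.
  apply: contrapT => /asboolP/mins; by rewrite leqNgt ltjs.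
have lets : (t <= s)%N by rewrite leqNgt; apply/negP => /step.
(* A submodule witnessing the failure is nonzero and proper in [radn V s], which therefore has
   length at least 2. *)
have lts : (s.+1 < l)%N.
  rewrite ltnNge; apply/negP => lels; apply: nstep => X sX XW.
  have [m + sm] := radn_length s fV; rewrite -/l => lem.
  have [->|neq] := pselect (X = radn V s); [by left|right].
  have [p [q [lepq sp sq]]] := series_refine sm sX (sub0_submodule sX) XW.
  case: p q sp sq lepq => [|p] [|q] sp sq lepq.
  - by inversion sq; subst; case: neq.
  - inversion sp; subst; exact: sub0_submodule (submodule_radn V s.+1).
  - by inversion sq; subst; case: neq.
  - have : (1 < l - s)%N.
      by apply: leq_trans lem; apply: leq_trans lepq; rewrite addSn addnS.
    by rewrite ltn_subRL addn1 ltnNge lels.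
exists (l - s)%N; first by rewrite ltn_subRL addn1 lts leq_sub2l.
have sl : (s <= l)%N by exact: ltnW (ltnW lts).
have sE : (l - (l - s) = s)%N by rewrite subKn.
have : (1 < l - s)%N by rewrite ltn_subRL addn1.
case: (l - s)%N sE (leq_subr s l) => [|[|k]] // sE lekl _.
rewrite /factor_serial -/l sE; split=> //;
  apply/(uniserial_quot_radn _ fV) => //.
by move/(_ s (ltnSn s)).
Qed.

Lemma maximal_uniq k K K' : finite_length V -> uniserial (quot_radn V k.+1) ->
  maximal_submodule K [set: V] -> maximal_submodule K' [set: V] -> K = K'.
Proof.
move=> fV /(uniserial_quot_radn _ fV)/(_ 0%N isT) step mK mK'.
have sK := maximal_submoduleP mK.
case: (step _ sK (@subsetT _ _)) => [eK|]; first by case: (maximal_neq mK).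
move=> /subset_trans /(_ (rad_sub_maximal mK')) KK'.
have [_ _ /(_ _ (maximal_submoduleP mK') KK' (@subsetT _ _))[//|eK']] := mK.
by case: (maximal_neq mK').
Qed.

(** The successor matters: a quotient by a positive radical power still sees layer 0, the top of
    [V]. *)
Lemma local_uniserial_quot_radn k : finite_length V -> [set: V] <> [set 0] ->
  uniserial (quot_radn V k.+1) -> local_module V.
Proof.
move=> fV V0 uV.
have [|K mK _] := exists_maximal fV (submodule_set0 V) (submodule_setT V)
  (@subsetT _ _).
  exact: nesym.
by exists K; split=> // K'; exact: maximal_uniq fV uV mK.
Qed.

End RadicalLayers.

(** * Subquotients *)

Section SubmoduleType.
Variables (R : pzRingType) (V : lmodType R) (S : set V) (sS : submodule S).

Record submodule_type := SubmoduleType {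
  submodule_val : V;
  _ : submodule_val \in submodule_pred sS }.

HB.instance Definition _ := [isSub for submodule_val].
HB.instance Definition _ := [Choice of submodule_type by <:].
HB.instance Definition _ := [SubChoice_isSubLmodule of submodule_type by <:].

End SubmoduleType.

(** [S / L] is used only through these three properties. Off [S], [insubd] makes [r] constant, hence
    linearity on [S] alone. *)
Lemma subquotient_exists (R : pzRingType) (V : lmodType R) (L S : set V) :
  submodule L -> submodule S -> L `<=` S ->
  exists (N : lmodType R) (r : V -> N),
    [/\ linear_on S r, forall y, exists2 x, S x & r x = y &
        forall x, S x -> r x = 0 <-> L x].
Proof.
move=> sL sS LS; have valP' (x : submodule_type sS) : S (val x).
  by have := valP x; rewrite /submodule_pred inE.
have val0 : val (0 : submodule_type sS) = 0 by exact: raddf0.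
have valL a (u v : submodule_type sS) : val (a *: u + v) = a *: val u + val v.
  exact: linearP.
have sL' : submodule [set x : submodule_type sS | L (val x)].
  apply: submoduleI => [|a u v Lu Lv]; rewrite /mkset ?val0 ?valL.
    exact: submodule0.
  exact: submodule_lin.
pose p : submodule_type sS -> quotient_module sL' := \pi_(quotient_module sL').
pose s (x : V) : submodule_type sS := insubd 0 x.
have sE x : S x -> val (s x) = x.
  by move=> Sx; rewrite val_insubd /submodule_pred mem_set.
exists (quotient_module sL' : lmodType R), (p \o s); split.
- move=> a u v Su Sv /=.
  have -> : s (a *: u + v) = a *: s u + s v.
    by apply: val_inj; rewrite valL !sE //; exact: submodule_lin.
  exact: (@quotient_pi_linear _ _ _ sL' setT).
- move=> y; have [x <-] := quotient_pi_onto y; exists (val x);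
    first exact: valP'.
  by apply: (congr1 p); apply: val_inj; rewrite sE.
- by move=> x Sx; rewrite /= (quotient_pi_eq0 sL') /= sE.
Qed.

Section Subquotient.
Variables (R : pzRingType) (V N : lmodType R) (L S : set V) (r : V -> N).
Hypotheses (sL : submodule L) (sS : submodule S) (LS : L `<=` S).
Hypotheses (lr : linear_on S r) (ronto : forall y, exists2 x, S x & r x = y)
  (rker : forall x, S x -> r x = 0 <-> L x).
Implicit Types (X Y : set V).

Let img X := image_plus [set 0] r X.
Let s0 := submodule_set0 N.

Lemma subquotient_image_sub X Y :
  submodule Y -> X `<=` S -> L `<=` Y -> Y `<=` S ->
  img X `<=` img Y -> X `<=` Y.
Proof.
move=> sY XS LY YS XY x Xx; have Sx := XS _ Xx.
have [|_ -> [y Yy]] := XY (r x); first by exists 0 => //; exists x;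
  rewrite ?add0r.
rewrite add0r => rxy; have Sy := YS _ Yy; rewrite -[x](subrK y).
apply: submoduleD => //; apply/LY/rker; first exact: submoduleB.
by rewrite (linear_onB sS lr) // rxy subrr.
Qed.

Lemma subquotient_image_bot : img L = [set 0].
Proof.
apply/seteqP; split=> [_ [_ -> [x Lx ->]]|_ ->].
  by rewrite add0r; apply/rker => //; exact: LS.
by apply: (image_plus_subl sS lr).
Qed.

Lemma subquotient_image_top : img S = [set: N].
Proof.
apply/seteqP; split=> // y _; have [x Sx <-] := ronto y.
by exists 0 => //; exists x; rewrite ?add0r.
Qed.

Lemma subquotient_maximal X Y : submodule Y -> L `<=` X -> Y `<=` S ->
  maximal_submodule X Y -> maximal_submodule (img X) (img Y).
Proof.
move=> sY LX YS mX; have XY := maximal_sub mX.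
have [e|//] := maximal_image_plus sS lr s0 sY YS mX.
case: (mX) => sX [_ nYX] _; case: nYX; apply: subquotient_image_sub => //.
  exact: subset_trans YS.
by rewrite /img e.
Qed.

Lemma subquotient_series n : series L S n -> series [set 0] [set: N] n.
Proof.
rewrite -subquotient_image_bot -subquotient_image_top.
apply: series_push_strict => [X sX XS|]; last exact: subquotient_maximal.
by apply: (submodule_image_plus sS lr).
Qed.

(** Preimages under [r] carry a decomposition of [S / L] to submodules between [L] and [S], so the
    glued module can be studied inside V x V. *)
Lemma subquotient_indecomposable : L <> S ->
  (forall X Y, submodule X -> submodule Y -> L `<=` X -> L `<=` Y ->
     X `<=` S -> Y `<=` S -> X `&` Y `<=` L ->
     (forall s, S s -> exists2 x, X x & exists2 y, Y y & s = x + y) ->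
     X `<=` L \/ Y `<=` L) ->
  indecomposable N.
Proof.
move=> neqLS indec; split=> [N0|X Y sX sY XY0 XYT].
  apply: neqLS; apply/seteqP; split=> // x Sx; apply/rker => //.
  by have : [set: N] (r x) by []; rewrite N0.
pose pre (Z : set N) := S `&` r @^-1` Z.
have spre Z (sZ : submodule Z) : submodule (pre Z).
  by apply: (submodule_preimage sS lr).
have Lpre Z (sZ : submodule Z) : L `<=` pre Z.
  move=> x Lx; have Sx := LS Lx; split=> //=.
  by have -> : r x = 0 by [apply/rker]; exact: submodule0.
have preL Z (sZ : submodule Z) : pre Z `<=` L -> Z = [set 0].
  move=> ZL; apply/seteqP; split=> [z Zz|]; last exact: sub0_submodule.
  by have [x Sx rx] := ronto z; rewrite -rx in Zz *; apply/rker/ZL.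
case: (indec _ _ (spre _ sX) (spre _ sY) (Lpre _ sX) (Lpre _ sY)).
- exact: subIsetl.
- exact: subIsetl.
- move=> x [[Sx Xx] [_ Yx]]; apply/rker => //.
  by have : (X `&` Y) (r x) by []; rewrite XY0.
- move=> s Ss; have [x Xx [y Yy sE]] := XYT (r s).
  have [x' Sx' rx'] := ronto x; rewrite -{}rx' in Xx sE.
  exists x' => //; exists (s - x'); last by rewrite addrC subrK.
  split=> /=; first exact: submoduleB.
  by rewrite (linear_onB sS lr) // sE addrC addKr.
- by move/preL; left; auto.
- by move/preL; right; auto.
Qed.

End Subquotient.

(** * The glued module *)

Section Product.
Variables (R : pzRingType) (V : lmodType R).
Implicit Types (A Z : set (V * V)%type) (K N T U : set V).

Lemma submoduleX K N : submodule K -> submodule N -> submodule (K `*` N).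
Proof.
move=> sK sN; apply: submoduleI => [|a u v [Ku Nu] [Kv Nv]].
  by split; exact: submodule0.
by split; exact: submodule_lin.
Qed.

Lemma linear_on_fst A : linear_on A (fst : V * V -> V). Proof. by []. Qed.

Lemma linear_on_snd A : linear_on A (snd : V * V -> V). Proof. by []. Qed.

Lemma linear_on_add A : linear_on A (fun z : V * V => z.1 + z.2).
Proof. by move=> a u v _ _; rewrite /= scalerDr addrACA. Qed.

Lemma maximal_setXl K N T : submodule N -> submodule T ->
  maximal_submodule K N -> maximal_submodule (K `*` T) (N `*` T).
Proof.
move=> sN sT mK.
have := maximal_preimage_onto (submoduleX sN sT) (@linear_on_fst _) sN mK.
rewrite (_ : _ `&` _ = K `*` T); last first.
  apply/seteqP; split=> [z [[? ?] ?]|z [Kz ?]] //.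
  by do 2!split => //; exact: (maximal_sub mK).
rewrite (_ : _ `&` _ = N `*` T); first apply.
  move=> y Ny; exists (y, 0) => //.
  by split=> //=; exact: submodule0.
by apply/seteqP; split=> [z []//|z [? ?]].
Qed.

Lemma maximal_setXr K N T : submodule N -> submodule T ->
  maximal_submodule K N -> maximal_submodule (T `*` K) (T `*` N).
Proof.
move=> sN sT mK.
have := maximal_preimage_onto (submoduleX sT sN) (@linear_on_snd _) sN mK.
rewrite (_ : _ `&` _ = T `*` K); last first.
  apply/seteqP; split=> [z [[? ?] ?]|z [? Kz]] //.
  by do 2!split => //; exact: (maximal_sub mK).
rewrite (_ : _ `&` _ = T `*` N); first apply.
  move=> y Ny; exists (0, y) => //.
  by split=> //=; exact: submodule0.
by apply/seteqP; split=> [z []//|z [? ?]].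
Qed.

Lemma submodule_section Z T : submodule Z -> submodule T ->
  submodule [set x | T x /\ Z (x, 0)].
Proof.
move=> sZ sT; apply: submoduleI => [|a u v [Tu Zu] [Tv Zv]].
  by split; [exact: submodule0|exact: (submodule0 sZ)].
split; first exact: submodule_lin.
have -> : (a *: u + v, 0) = a *: (u, 0) + (v, 0) :> V * V.
  by congr (_, _); rewrite /= scaler0 addr0.
exact: submodule_lin.
Qed.

Lemma submodule_proj2 Z T U : submodule Z -> submodule T -> submodule U ->
  submodule [set y | U y /\ exists2 x, T x & Z (x, y)].
Proof.
move=> sZ sT sU; apply: submoduleI => [|a u v [Uu [x Tx Zx]] [Uv [x' Tx' Zx']]].
  by split; [exact: submodule0|exists 0;
    [exact: submodule0|exact: (submodule0 sZ)]].
split; first exact: submodule_lin.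
exists (a *: x + x'); first exact: submodule_lin.
exact: (submodule_lin a sZ Zx Zx').
Qed.

Lemma submodule_proj1 Z T U : submodule Z -> submodule T -> submodule U ->
  submodule [set x | T x /\ exists2 y, U y & Z (x, y)].
Proof.
move=> sZ sT sU; apply: submoduleI => [|a u v [Uu [x Tx Zx]] [Uv [x' Tx' Zx']]].
  by split; [exact: submodule0|exists 0;
    [exact: submodule0|exact: (submodule0 sZ)]].
split; first exact: submodule_lin.
exists (a *: x + x'); first exact: submodule_lin.
exact: (submodule_lin a sZ Zx Zx').
Qed.

End Product.

Section Glue.
Variables (R : pzRingType) (V : lmodType R) (P Q W K1 K2 : set V).
Hypotheses (sP : submodule P) (mQ : maximal_submodule Q P)
  (mW : maximal_submodule W Q) (mK1 : maximal_submodule K1 W)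
  (mK2 : maximal_submodule K2 W) (neqK : K1 <> K2).
Hypotheses
  (localP : forall X, submodule X -> X `<=` P -> X = P \/ X `<=` Q)
  (localQ : forall X, submodule X -> X `<=` Q -> X = Q \/ X `<=` W).
Implicit Types (X Y Z : set (V * V)%type).

Let sQ := maximal_submoduleP mQ.
Let sW := maximal_submoduleP mW.
Let sK1 := maximal_submoduleP mK1.
Let sK2 := maximal_submoduleP mK2.
Let QP := maximal_sub mQ.
Let WQ := maximal_sub mW.
Let K1W := maximal_sub mK1.
Let K2W := maximal_sub mK2.

(* (P `*` Q) / glue is the pushout of P / (K1 `&` K2) and Q / K2 along
   W / K2: glue is generated by 0 `*` K2, (K1 `&` K2) `*` 0 and the
   antidiagonal of K1. *)
Definition glue : set (V * V)%type :=
  [set z | [/\ K1 z.1, W z.2 & K2 (z.1 + z.2)]].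

(** [glue] is the preimage of [K2] under addition, which maps K1 x W onto [W]. *)
Lemma glue_maximal : maximal_submodule glue (K1 `*` W).
Proof.
have := maximal_preimage_onto (submoduleX sK1 sW) (@linear_on_add _ _ _) sW mK2.
rewrite (_ : _ `&` _ = glue); last first.
  by apply/seteqP; split=> [z [[? ?] ?]|z [? ? ?]].
rewrite (_ : _ `&` _ = K1 `*` W); first apply.
  move=> y Wy; exists (0, y); last by rewrite /= add0r.
  by split=> //=; exact: submodule0.
apply/seteqP; split=> [z []//|z [Kz Wz]]; split=> //=.
by apply: submoduleD => //; exact: K1W.
Qed.

Lemma glue_series : series glue (P `*` Q) 5.
Proof.
apply: (@series_step _ _ _ (P `*` W)); last exact: submoduleX.
  apply: (@series_step _ _ _ (Q `*` W)); last exact: submoduleX.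
    apply: (@series_step _ _ _ (W `*` W)); last exact: submoduleX.
      apply: (@series_step _ _ _ (K1 `*` W)); last exact: submoduleX.
        by apply: series1; [exact: glue_maximal|exact: submoduleX].
      exact: maximal_setXl.
    exact: maximal_setXl.
  exact: maximal_setXl.
exact: maximal_setXr.
Qed.

Lemma submodule_glue : submodule glue.
Proof. exact: series_submodl glue_series. Qed.

Lemma glue_sub : glue `<=` P `*` Q.
Proof. exact: series_sub glue_series. Qed.

Lemma glueWW : glue `<=` W `*` W.
Proof. by move=> z [Kz Wz _]; split=> //; exact: K1W. Qed.

Lemma glue_diag k : K1 k -> glue (k, - k).
Proof.
move=> K1k; split=> //=; first exact/(submoduleN sW)/K1W.
by rewrite subrr; exact: submodule0.
Qed.

Lemma maximal_incomparable (K K' : set V) : maximal_submodule K W ->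
  maximal_submodule K' W -> K <> K' -> exists2 x, K x & ~ K' x.
Proof.
move=> mK mK' neq; apply: contrapT => nx.
have KK' : K `<=` K'.
  by move=> x Kx; apply: contrapT => nK'x; apply: nx; exists x.
have [_ _ /(_ _ (maximal_submoduleP mK') KK' (maximal_sub mK'))[eK|eK]] := mK.
  exact: neq.
exact: maximal_neq mK' eK.
Qed.

Lemma maximal_sum w : W w -> exists2 k1, K1 k1 & exists2 k2, K2 k2 & w = k1 +
  k2.
Proof.
move=> Ww; have [k2 K2k2 nK1] := maximal_incomparable mK2 mK1 (nesym neqK).
have [_ _ max1] := mK1.
have [| | |eK|eW] := max1 (image_plus K1 id K2).
- exact: submodule_plus.
- by move=> x K1x; exists x => //; exists 0; [exact: submodule0|rewrite addr0].
- move=> _ [x K1x [y K2y ->]].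
  by apply: submoduleD => //; [exact: K1W|exact: K2W].
- case: nK1; rewrite -eK; exists 0; first exact: submodule0.
  by exists k2; rewrite ?add0r.
- by move: Ww; rewrite -eW.
Qed.

(** As W = K1 + K2, a second coordinate in [W] can be traded, modulo [glue], for a first coordinate
    in [K1]. *)
Lemma glue_lift y : W y -> exists2 k, K1 k & glue (k, y).
Proof.
move=> Wy; have [k1 K1k1 [k2 K2k2 yE]] := maximal_sum Wy.
exists (- k1); first exact: submoduleN.
by split=> //=; [exact: submoduleN|rewrite yE addKr].
Qed.

Lemma glue_drop Z x y : submodule Z -> glue `<=` Z -> Z (x, y) -> W y ->
  exists2 k, K1 k & Z (x - k, 0).
Proof.
move=> sZ LZ Zxy Wy; have [k K1k Lk] := glue_lift Wy; exists k => //.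
have := submoduleB sZ Zxy (LZ _ Lk).
by rewrite (_ : _ - _ = (x - k, 0)) //; congr (_, _); rewrite /= subrr.
Qed.

(* Nakayama's lemma for the radical QxW / glue of (PxQ) / glue. *)
Lemma glue_superfluous Z : submodule Z -> glue `<=` Z -> Z `<=` P `*` Q ->
  (forall s, (P `*` Q) s -> exists2 z, Z z & exists2 q, (Q `*` W) q & s = z +
    q) ->
  P `*` Q `<=` Z.
Proof.
move=> sZ LZ ZS sumS.
have P0 x : P x -> Z (x, 0).
  have sZ1 := submodule_section sZ sP.
  (* If the section were inside [Q], clearing the second coordinate modulo [glue] would put all of
     [P] in [Q]. *)
  have [|<-|sub] := localP sZ1; [by move=> ? []|by move=> []|].
  case: (maximal_neq mQ); apply/seteqP; split=> // p Pp.
  have [|[z1 z2] Zz [[q w] [Qq Ww]] [pE zw]] := sumS (p, 0).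
    by split=> //; exact: submodule0.
  have Wz2 : W z2.
    by rewrite (_ : z2 = - w); [exact: submoduleN|apply/eqP;
      rewrite -addr_eq0 -zw].
  have [k K1k Zk] := glue_drop sZ LZ Zz Wz2.
  have Qzk : Q (z1 - k).
    by apply: sub; split=> //; have [] := ZS _ Zk.
  rewrite pE; apply: submoduleD => //; rewrite -[z1](subrK k).
  by apply: submoduleD => //; exact/WQ/K1W.
have Q2 y : Q y -> exists2 x, P x & Z (x, y).
  have sZ2 := submodule_proj2 sZ sP sQ.
  have [|eQ|sub] := localQ sZ2; [by move=> ? []|by rewrite -{1}eQ => -[]|].
  case: (maximal_neq mW); apply/seteqP; split=> // q Qq.
  have [|[z1 z2] Zz [[q' w] [_ Ww]] [_ qE]] := sumS (0, q).
    by split=> //; exact: submodule0.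
  rewrite qE; apply: submoduleD => //; apply: sub; have [/= Pz1 Qz2] := ZS _ Zz.
  by split=> //; exists z1.
move=> [x y] [/= Px Qy]; have [x' Px' Zx'] := Q2 _ Qy.
rewrite (_ : (x, y) = (x - x', 0) + (x', y)); last by congr (_, _);
  rewrite /= ?subrK ?add0r.
by apply: submoduleD => //; apply: P0; exact: submoduleB.
Qed.

(** Clearing the second coordinate identifies (Q x W) / glue with Q / (K1 cap K2), which inherits
    locality from [localQ]. *)
Lemma glue_local Z : submodule Z -> glue `<=` Z -> Z `<=` Q `*` W ->
  Q `*` W `<=` Z \/ Z `<=` W `*` W.
Proof.
move=> sZ LZ ZR; have sZ1 := submodule_section sZ sQ.
have [|eQ|sub] := localQ sZ1; first by move=> ? [].
  left=> -[x y] [/= Qx Wy]; have [k K1k Lk] := glue_lift Wy.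
  rewrite (_ : (x, y) = (x - k, 0) + (k, y)); last by congr (_, _);
    rewrite /= ?subrK ?add0r.
  apply: submoduleD => //; last exact: LZ.
  suff : Q (x - k) by rewrite -{1}eQ => -[].
  by apply: submoduleB => //; exact/WQ/K1W.
right=> -[x y] Zxy; have [/= Qx Wy] := ZR _ Zxy; split=> //=.
have [k K1k Zk] := glue_drop sZ LZ Zxy Wy.
rewrite -[x](subrK k); apply: submoduleD => //; last exact: K1W.
by apply: sub; split=> //; apply: submoduleB => //; exact/WQ/K1W.
Qed.

(* The socle of (PxQ) / glue lies in its radical. *)
Lemma glue_essential Y : submodule Y -> glue `<=` Y -> Y `<=` P `*` Q ->
  Y `&` (Q `*` W) `<=` glue -> Y `<=` glue.
Proof.
move=> sY LY YS YR.
(* Here only [x] in [Q] is at stake; afterwards it remains to force all second coordinates of [Y]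
   into [W]. *)
have YA x y : Y (x, y) -> W y -> glue (x, y).
  move=> Yxy Wy; apply: (YR); split=> //; split=> //=.
  have sY1 := submodule_section sY sP.
  have [|eP|sub] := localP sY1; first by move=> ? [].
    case: (maximal_neq mW); apply/seteqP; split=> // q Qq.
    suff : glue (q, 0) by case=> /K1W.
    apply: YR; split; last by split=> //; exact: submodule0.
    by have := QP Qq; rewrite -{1}eP => -[].
  have [k K1k Yk] := glue_drop sY LY Yxy Wy.
  rewrite -[x](subrK k); apply: submoduleD => //; last exact/WQ/K1W.
  by apply: sub; split=> //; have [] := YS _ Yk.
suff YW : forall x y, Y (x, y) -> W y by move=> [x y] Yxy;
  exact: YA (YW _ _ Yxy).
(* Suppose all of [Q] is paired in [Y] with elements of [W]. Subtracting antidiagonal elements moves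
   the partners into [K2] at the cost of [K1], so the elements paired with [K2] are not all in [W]
   and fill [Q]. An element of [K1] outside [K2] then has a partner in [K2], which [glue]
   forbids. *)
have sF := submodule_proj2 sY sW sQ.
have [|eF|sub] := localQ sF; first by move=> ? [].
  have sD := submodule_proj2 sY sK2 sQ.
  have [|eD|subD] := localQ sD; first by move=> ? [].
    have [y K1y nK2y] := maximal_incomparable mK1 mK2 neqK.
    have : Q y by exact/WQ/K1W.
    rewrite -{1}eD => -[_ [x' K2x' /YA[|_ _ /= K2xy]]]; first exact: K1W.
    by case: nK2y; rewrite -[y](addKr x') addrC; exact: submoduleB.
  case: (maximal_neq mW); apply/seteqP; split=> // y Qy.
  move: (Qy); rewrite -{1}eF => -[_ [w Ww Ywy]].
  have [k1 K1k1 [k2 K2k2 wE]] := maximal_sum Ww.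
  have Yk : Y (k2, y + k1).
    have := submoduleB sY Ywy (LY _ (glue_diag K1k1)).
    by rewrite (_ : _ - _ = (k2, y + k1)) //; congr (_, _);
      rewrite /= ?opprK // wE addrC addKr.
  rewrite -[y](addrK k1); apply: submoduleB => //; last exact: K1W.
  apply: subD; split; last by exists k2.
  by apply: submoduleD => //; exact/WQ/K1W.
(* The first projection of [Y] cannot contain [W], or [YA] would put [W] inside [K1]. Locality of
   [P] and [Q] then pushes it down into [W], where [sub] applies. *)
have sE := submodule_proj1 sY sP sQ.
have noW : ~ W `<=` [set x | P x /\ exists2 y, Q y & Y (x, y)].
  move=> WE; apply: (maximal_neq mK1); apply/seteqP; split=> // w Ww.
  have [_ [y' Qy' Ywy]] := WE _ Ww.
  by have [|] := YA _ _ Ywy; first by apply: sub; split=> //; exists w.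
have [|eP|subP] := localP sE; first by move=> ? [].
  by case: noW; rewrite eP; exact: subset_trans QP.
have [|eQ|subQ] := localQ sE => //.
  by case: noW; rewrite eQ.
move=> x y Yxy; have [/= Px Qy] := YS _ Yxy; apply: sub; split=> //.
by exists x => //; apply: subQ; split=> //; exists y.
Qed.

Lemma glue_indecomposable X Y : submodule X -> submodule Y ->
  glue `<=` X -> glue `<=` Y -> X `<=` P `*` Q -> Y `<=` P `*` Q ->
  X `&` Y `<=` glue ->
  (forall s, (P `*` Q) s -> exists2 x, X x & exists2 y, Y y & s = x + y) ->
  X `<=` glue \/ Y `<=` glue.
Proof.
move=> sX sY LX LY XS YS XY sumS.
have sS := submoduleX sP sQ; have sR := submoduleX sQ sW.
have RS : Q `*` W `<=` P `*` Q by move=> z [Qz Wz]; split;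
  [exact: QP|exact: WQ].
have LR : glue `<=` Q `*` W.
  by move=> z /glueWW[Wz Wz']; split=> //; exact: WQ.
(* If [X] is not inside [A], then Y + (X cap A) is maximal or everything, so by superfluity it
   contains Q x W. Comparing the two decompositions of [x + y] modulo [glue] puts [x] in [A]. *)
have proj A x y : maximal_submodule A (P `*` Q) -> glue `<=` A ->
    X x -> Y y -> (Q `*` W) (x + y) -> A x.
  move=> mA LA Xx Yy Rxy.
  have sA := maximal_submoduleP mA.
  have [XA|nXA] := pselect (X `<=` A); first exact: XA.
  have mXA := maximal_capl sS sX mA XS nXA.
  pose G := image_plus Y id (X `&` A).
  have sG : submodule G by apply: submodule_plus => //; exact: submodule_cap.
  have YG : Y `<=` G.
    move=> z Yz; exists z => //; exists 0; last by rewrite addr0.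
    by split; exact: submodule0.
  have GS : G `<=` P `*` Q.
    move=> _ [u Yu [v [Xv _] ->]].
    by apply: submoduleD => //; [exact: YS|exact: XS].
  have YXE : image_plus Y id X = P `*` Q.
    apply/seteqP; split=> [_ [u Yu [v Xv ->]]|s /sumS[u Xu [v Yv ->]]].
      by apply: submoduleD => //; [exact: YS|exact: XS].
    by exists v => //; exists u => //; rewrite addrC.
  suff RG : Q `*` W `<=` G.
    have [u Yu [v [Xv Av] xyE]] := RG _ Rxy.
    rewrite -[x](subrK v); apply: submoduleD => //; apply/LA/XY; split.
      exact: submoduleB.
    have -> : x - v = u - y by apply/eqP;
      rewrite subr_eq addrAC -subr_eq opprK xyE.
    exact: submoduleB.
  have [GE|mG] := maximal_plus sY sX mXA.
    by rewrite /G GE YXE.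
  rewrite YXE in mG; have [_ _ maxG] := mG.
  have [| | |eG|eS] := maxG (image_plus G id (Q `*` W)).
  - exact: submodule_plus.
  - by move=> z Gz; exists z => //; exists 0; [exact: submodule0|rewrite addr0].
  - move=> _ [u Gu [v Rv ->]].
    by apply: submoduleD => //; [exact: GS|exact: RS].
  - move=> z Rz; rewrite /G -eG; exists 0; first exact: submodule0.
    by exists z => //; rewrite add0r.
  - apply: subset_trans RS _; apply: glue_superfluous => //.
      exact: subset_trans LY YG.
    by rewrite -{1}eS.
(* Q x W is the intersection of the maximal submodules P x W and Q x Q. *)
have projR x y : X x -> Y y -> (Q `*` W) (x + y) -> (Q `*` W) x.
  move=> Xx Yy Rxy.
  have [|_ Wx] := proj (P `*` W) _ _ (maximal_setXr sQ sP mW) _ Xx Yy Rxy.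
    by move=> z /glueWW[Wz Wz']; split=> //; exact/QP/WQ.
  have [|Qx _] // := proj (Q `*` Q) _ _ (maximal_setXl sP sQ mQ) _ Xx Yy Rxy.
  by move=> z /glueWW[Wz Wz']; split=> //; exact/WQ.
have sumR s : (Q `*` W) s -> exists2 x, (X `&` (Q `*` W)) x &
    exists2 y, (Y `&` (Q `*` W)) y & s = x + y.
  move=> Rs; have [x Xx [y Yy sE]] := sumS _ (RS _ Rs).
  rewrite sE in Rs *; have Rx := projR _ _ Xx Yy Rs.
  exists x => //; exists y => //; split=> //.
  by rewrite -[y](addKr x) addrC; exact: submoduleB.
have capR Z : submodule Z -> glue `<=` Z ->
    Q `*` W `<=` Z \/ Z `&` (Q `*` W) `<=` W `*` W.
  move=> sZ LZ; case: (@glue_local (Z `&` (Q `*` W))).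
  - exact: submodule_cap.
  - by move=> z Lz; split; [exact: LZ|exact: LR].
  - exact: subIsetr.
  - by move=> RZ; left=> z /RZ[].
  - by right.
have fin X' Y' : submodule Y' -> glue `<=` Y' -> Y' `<=` P `*` Q ->
    X' `&` Y' `<=` glue -> Q `*` W `<=` X' -> Y' `<=` glue.
  move=> sY' LY' YS' XY' RX'; apply: glue_essential => // z [Y'z Rz].
  by apply: XY'; split=> //; exact: RX'.
case: (capR _ sX LX) => [RX|XW]; first by right; apply: fin RX.
case: (capR _ sY LY) => [RY|YW].
  by left; apply: fin RY => //; rewrite setIC.
(* Otherwise both summands meet Q x W inside W x W, and by [sumR] so does all of Q x W. *)
case: (maximal_neq mW); apply/seteqP; split=> // q Qq.
have [|x /XW[Wx _] [y /YW[Wy _] [qE _]]] := sumR (q, 0).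
  by split=> //; exact: submodule0.
by rewrite qE; exact: submoduleD.
Qed.

Lemma glue_module : exists N : lmodType R,
  [/\ finitely_generated N, indecomposable N, module_length N = 5%N &
      ~ local_module N].
Proof.
have sS := submoduleX sP sQ.
have [N [r [lr ronto rker]]] := subquotient_exists submodule_glue sS glue_sub.
have s5 := subquotient_series submodule_glue sS glue_sub lr ronto rker
  glue_series.
have fN : finite_length N by exists 5%N.
exists N; split=> //.
- exact: finite_length_finitely_generated.
- apply: (subquotient_indecomposable sS glue_sub lr ronto rker).
    move=> e; have : series glue glue 0 by exact: series_refl submodule_glue.
    by rewrite {2}e => /(series_uniq glue_series).
  exact: glue_indecomposable.
- exact: module_lengthE.
case=> M [_ uM]; have LA : glue `<=` P `*` W.
  by move=> z /glueWW[Wz Wz']; split=> //; exact/QP/WQ.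
have LB : glue `<=` Q `*` Q.
  by move=> z /glueWW[Wz Wz']; split=> //; exact/WQ.
have mA := maximal_setXr sQ sP mW; have mB := maximal_setXl sP sQ mQ.
have eAB : image_plus [set 0] r (P `*` W) = image_plus [set 0] r (Q `*` Q).
  rewrite -[LHS]uM -?[RHS]uM // -(subquotient_image_top ronto);
    exact: (subquotient_maximal sS lr rker sS).
have AB : P `*` W `<=` Q `*` Q.
  apply: (subquotient_image_sub sS lr rker) => //.
  - exact: submoduleX.
  - exact: maximal_sub mA.
  - exact: maximal_sub mB.
  - by rewrite eAB.
case: (maximal_neq mQ); apply/seteqP; split=> // p Pp.
by have [|] := AB (p, 0); first by split=> //; exact: submodule0.
Qed.

End Glue.

(** * The theorem *)

Lemma radn_step_maximal (R : pzRingType) (V : lmodType R) j :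
  finite_length V -> radn V j <> [set 0] -> radn_step V j ->
  maximal_submodule (radn V j.+1) (radn V j).
Proof.
move=> fV W0 step; apply: maximal_submoduleI.
- exact: submodule_radn.
- exact: rad_sub.
- exact: rad_neq fV (submodule_radn V j) W0.
- move=> L sL WL LW neq; case: (step L sL LW) => [->//|LW'].
  by case: neq; apply/seteqP.
Qed.

(** The index [t.+2] leaves room for two simple layers above the first fork; they are nonzero
    because the forking term is. *)
Lemma fork_not_local (R : pzRingType) (V : lmodType R) t : finite_length V ->
  uniserial (quot_radn V t.+2) -> ~ uniserial (quot_radn V t.+3) ->
  exists N : lmodType R,
  [/\ finitely_generated N, indecomposable N, module_length N = 5%N &
      ~ local_module N].
Proof.
move=> fV /(uniserial_quot_radn _ fV) step nu.
have [X [sX XW neqX nXW]] : exists X, [/\ submodule X, X `<=` radn V t.+2,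
    X <> radn V t.+2 & ~ X `<=` radn V t.+3].
  apply: contrapT => noX; apply/nu/(uniserial_quot_radn _ fV) => j.
  rewrite ltnS leq_eqVlt => /predU1P[->|]; last exact: step.
  move=> X sX XW; have [->|neqX] := pselect (X = radn V t.+2); first by left.
  by right; apply: contrapT => nXW; apply: noX; exists X.
set W := radn V t.+2 in XW neqX *.
have sW : submodule W by exact: submodule_radn.
have W0 : W <> [set 0].
  move=> W0; apply: neqX; apply/seteqP; split=> //.
  by rewrite W0; exact: sub0_submodule.
have up j : (j <= t.+2)%N -> radn V j <> [set 0].
  move=> lej Wj0; apply: W0; apply/seteqP; split; last exact: sub0_submodule.
  by rewrite -Wj0; exact: radn_sub.
(* [K1] will contain [X], while [K2] misses an element of [X] outside the next radical; hence they
   differ. *)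
have [K1 mK1 XK1] := exists_maximal fV sX sW XW neqX.
have [x Xx nx] : exists2 x, X x & ~ radn V t.+3 x.
  apply: contrapT => nox; apply: nXW => x Xx.
  by apply: contrapT => nx; apply: nox; exists x.
have [K2 mK2 nK2x] : exists2 K2, maximal_submodule K2 W & ~ K2 x.
  apply: contrapT => noK; apply: nx; split; first exact: XW.
  by move=> K mK; apply: contrapT => nKx; apply: noK; exists K.
have stepP := step t (leqnSn t.+1); have stepQ := step t.+1 (ltnSn t.+1).
apply: (@glue_module _ V (radn V t) (radn V t.+1) W K1 K2) => //.
- exact: submodule_radn.
- by apply: radn_step_maximal => //; apply: up;
    exact: leq_trans (leqnSn _) (leqnSn _).
- by apply: radn_step_maximal => //; exact: up.
- by move=> eK; apply: nK2x; rewrite -eK; exact: XK1.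
Qed.

Theorem theorem2p7 (R : comPzRingType) (A : algType R) :
  artin_algebra A -> ~ nakayama A -> ~ right_nakayama 2 A ->
  (right_nakayama 3 A <->
   (forall M : lmodType A^c, finitely_generated M -> indecomposable M ->
      (4 < module_length M)%N -> uniserial M) /\
   (forall M : lmodType A^c, finitely_generated M -> indecomposable M ->
      module_length M = 4%N -> local_module M)).
Proof.
move=> artA nnak n2nak.
have fin (M : lmodType A^c) (fgM : finitely_generated M) : finite_length M.
  exact: finite_length_artin_algebra artA fgM.
have factor_quot (M : lmodType A^c) i : factor_serial M i -> ~ uniserial M ->
    uniserial (quot_radn M (module_length M - i)) /\
    ~ uniserial (quot_radn M (module_length M - i).+1).
  by case: i => [|[|i]] //= [].
split=> [[_ serial _]|[long_uniserial four_local]]; last first.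
  have serial (M : lmodType A^c) : finitely_generated M -> indecomposable M ->
      uniserial M \/ exists2 i, (1 < i <= 3)%N & factor_serial M i.
    move=> fgM indM; have [uM|nuM] := pselect (uniserial M); [by left|right].
    have fM := fin _ fgM.
    have short : (module_length M <= 4)%N.
      by rewrite leqNgt; apply/negP => /(long_uniserial _ fgM indM).
    have quot1 : module_length M = 4%N -> uniserial (quot_radn M 1).
      move=> /(four_local _ fgM indM)[K [mK uK]].
      apply/(uniserial_quot_radn _ fM) => -[|//] _ X sX XT.
      have [->|neqX] := pselect (X = setT); [by left|right].
      have [K' mK' XK'] := exists_maximal fM sX (submodule_setT M) XT neqX.
      move=> x Xx; split=> // L mL; rewrite -(uK _ mL) (uK _ mK'); exact: XK'.
    (* For length 4 locality allows [t = 1]; for shorter modules [t = 0] imposes nothing. *)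
    have [t lt3 ut] : exists2 t, (module_length M - t <= 3)%N &
        uniserial (quot_radn M t).
      have [/quot1 u1|neq4] := eqVneq (module_length M) 4%N.
        by exists 1%N => //; move: short;
          case: (module_length M) => // -[|[|[|[|[]]]]].
      exists 0%N; first by rewrite subn0 -ltnS ltn_neqAle neq4.
      by apply/(uniserial_quot_radn _ fM).
    have [i /andP[lt1 lei] si] := factor_serial_exists fM nuM ut.
    by exists i => //; rewrite lt1 (leq_trans lei).
  split=> // [M fgM indM|].
    have [uM|[i /andP[lt1 le3] si]] := serial _ fgM indM; first by exists 1%N.
    by exists i => //; rewrite le3 (ltnW lt1).
  (* Without 3-factor serial indecomposables, [A] is right 2-Nakayama if a 2-factor serial one
     exists, and Nakayama otherwise. *)
  apply: contrapT => no3; apply: n2nak; split=> // [M fgM indM|].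
    have [uM|[i /andP[lt1 le3] si]] := serial _ fgM indM; first by exists 1%N.
    exists i => //; rewrite (ltnW lt1) -ltnS ltn_neqAle le3 andbT.
    by apply/eqP => i3; apply: no3; exists M; rewrite -i3.
  apply: contrapT => no2; apply: nnak => M fgM indM.
  have [//|[[|[|[|[|i]]]] // _ si]] := serial _ fgM indM.
    by case: no2; exists M.
  by case: no3; exists M.
(* As i <= 3 < l, the uniserial quotient of a non-uniserial [M] is by a positive radical power. *)
have is_local (M : lmodType A^c) : finitely_generated M -> indecomposable M ->
    (3 < module_length M)%N -> local_module M.
  move=> fgM indM lM; have fM := fin _ fgM.
  have M0 : [set: M] <> [set 0] by case: indM.
  have [i /andP[i0 i3] si] := serial _ fgM indM.
  have [uM|nuM] := pselect (uniserial M).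
    apply: (@local_uniserial_quot_radn _ _ 0) => //.
    apply/(uniserial_quot_radn _ fM) => j; rewrite ltnS leqn0 => /eqP->.
    by apply: (iffLR (uniserial_radn fM) uM); exact: leq_trans lM.
  have [uq _] := factor_quot _ _ si nuM.
  apply: (@local_uniserial_quot_radn _ _ (module_length M - i).-1) => //.
  by rewrite prednK // subn_gt0; exact: leq_ltn_trans i3 _.
split=> M fgM indM lM; last by apply: is_local; rewrite ?lM.
apply: contrapT => nuM; have [i /andP[i0 i3] si] := serial _ fgM indM.
have [uq nuq] := factor_quot _ _ si nuM.
(* Length above 4 with [i <= 3] puts the first fork at depth at least 2, as [fork_not_local]
   requires. *)
have : (1 < module_length M - i)%N.
  by rewrite ltn_subRL addn1; exact: leq_trans lM.
case: (module_length M - i)%N uq nuq => [|[|t]] // uq nuq _.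
have [N [fgN indN lN]] := fork_not_local (fin _ fgM) uq nuq.
by apply; apply: is_local; rewrite ?lN.
Qed.
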